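(* Let $S$ be a $\mathrm{D}$-free skew shape of height $h$ and width $w$. Then there is a bijection $\phi\mapsto\phi'$ from the set of all (nonnegative integer) fillings of $S$ to itself with the following properties. (1) For every $k\ge 1$ and every filling $\phi$ of $S$, $\phi$ avoids $\delta_k$ if and only if $\phi'$ avoids $\iota_k$. (2) There is a permutation $\rho$ of the row indices $\{1,\dots,h\}$ of $S$ and a permutation $\sigma$ of the column indices $\{1,\dots,w\}$ of $S$ such that for every filling $\phi$ of $S$ and every index $i$, the entries in the $i$-th row of $\phi$ have the same sum as the entries in the $\rho_i$-th row of $\phi'$, and the entries in the $i$-th column of $\phi$ have the same sum as the entries in the $\sigma_i$-th column of $\phi'$.
   Context: A cell is a unit square with vertices in $\mathbb{Z}^2$; its coordinates are those of its top-right corner, so cell $(i,j)$ is the cell in column $i$ and row $j$ (columns numbered left to right, rows numbered bottom to top). A shape is a finite union of cells; shapes are considered up to translation and, unless stated otherwise, a nonempty shape is placed so that its leftmost cell has column coordinate $1$ and its bottommost cell has row coordinate $1$. The height (width) of a shape is the row coordinate of its topmost cell (the column coordinate of its rightmost cell). A NW Ferrers shape is a top-left justified Young-diagram shape: every row is a contiguous run of cells, every column is a contiguous run of cells, all rows have their leftmost cell in the same column, and all columns have their topmost cell in the same row. A skew shape is a shape of the form $S=F_1\setminus F_2$ (the cells of $F_1$ not belonging to $F_2$), where $F_1$ and $F_2$ are NW Ferrers shapes with the same top-left cell ($F_2$ may be empty). Containment of shapes: a shape $S$ of height $h$ and width $w$ contains a shape $T$ of height $k$ and width $\ell$ if there are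 row indices $1\le r_1<\dots<r_k\le h$ and column indices $1\le c_1<\dots<c_\ell\le w$ such that for all $1\le i\le \ell$, $1\le j\le k$, the cell $(i,j)$ belongs to $T$ if and only if the cell $(c_i,r_j)$ belongs to $S$. Such rows and columns form an occurrence of $T$ in $S$. Otherwise $S$ avoids $T$. $\mathrm{D}$ is the skew shape obtained from the $3\times3$ square $\{(i,j):1\le i,j\le 3\}$ by removing the top-left cell $(1,3)$ and the bottom-right cell $(3,1)$ (so it has 7 cells). A skew shape is $\mathrm{D}$-free if it avoids $\mathrm{D}$. A filling of a shape $S$ is a function assigning a nonnegative integer to each cell of $S$. A filling $\phi_S$ of $S$ contains a filling $\phi_T$ of $T$ if there is an occurrence of $T$ in $S$, in rows $r_1<\dots<r_k$ and columns $c_1<\dots<c_\ell$, such that $\phi_T(i,j)\le\phi_S(c_i,r_j)$ for every cell $(i,j)$ of $T$; otherwise $\phi_S$ avoids $\phi_T$. For $k\ge1$, $\iota_k$ is the filling of the $k\times k$ square shape with value $1$ in the cells $(i,i)$, $1\le i\le k$, and $0$ elsewhere; $\delta_k$ is the filling of the $k\times k$ square shape with value $1$ in the cells $(i,k+1-i)$, $1\le i\le k$, and $0$ elsewhere. (In particular, an occurrence of $\iota_k$ or $\delta_k$ requires all $k^2$ cells in the chosen rows and columns to belong to $S$.) *)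

(* Defs.v *)
From mathcomp Require Import all_boot all_order all_algebra all_fingroup.
From mathcomp Require Import finmap.

Set Implicit Arguments.
Unset Strict Implicit.
Unset Printing Implicit Defensive.

Import Order.TTheory GRing.Theory Num.Theory.

(* A shape is a set of cells (column, row) in a w x h box; columns run from
   left to right and rows from bottom to top.  Coordinates are 0-based, so the
   ordinals i and j stand for column i.+1 and row j.+1. *)
Definition grid_shape (w h : nat) := {set 'I_w * 'I_h}.

Definition width w h (S : grid_shape w h) : nat :=
  \max_(c in S) (c.1 : 'I_w).+1.

Definition height w h (S : grid_shape w h) : nat :=
  \max_(c in S) (c.2 : 'I_h).+1.

(* The box w x h is exactly the bounding box of S (for the empty shape this
   forces w = h = 0). *)
Definition has_size w h (S : grid_shape w h) : Prop :=
  [/\ width S = w, height S = h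
    & S != set0 ->
      (exists2 c, c \in S & c.1 = 0 :> nat) /\
      (exists2 c, c \in S & c.2 = 0 :> nat)].

Definition zcells w h (S : grid_shape w h) : {fset int * int} :=
  [fset (Posz (c.1 : 'I_w).+1, Posz (c.2 : 'I_h).+1) | c in S]%fset.

(* The empty set is NW_Ferrers a b for every (a, b); a nonempty F is so for at
   most one (a, b), which is then its top-left cell. *)
Definition NW_Ferrers (a b : int) (F : {fset int * int}) : Prop :=
  [/\ forall i m i' j : int, (i, j) \in F -> (i', j) \in F ->
        (i <= m <= i')%R -> (m, j) \in F,
      forall i j m j' : int, (i, j) \in F -> (i, j') \in F ->
        (j <= m <= j')%R -> (i, m) \in F,
      forall i j : int, (i, j) \in F -> (a, j) \in F /\ (a <= i)%R
    & forall i j : int, (i, j) \in F -> (i, b) \in F /\ (j <= b)%R].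

(* F1 and F2 need not fit in the bounding box of F1 \ F2, hence the passage to
   cells in Z^2. *)
Definition skew_shape w h (S : grid_shape w h) : Prop :=
  exists (a b : int) (F1 F2 : {fset int * int}),
    [/\ NW_Ferrers a b F1, NW_Ferrers a b F2 & zcells S = (F1 `\` F2)%fset].

Definition occurrence w h l k (S : grid_shape w h) (T : grid_shape l k)
    (c : 'I_l -> 'I_w) (r : 'I_k -> 'I_h) : Prop :=
  [/\ {homo c : i j / (i < j)%N}, {homo r : i j / (i < j)%N}
    & forall i j, ((i, j) \in T) = ((c i, r j) \in S)].

Definition contains w h l k (S : grid_shape w h) (T : grid_shape l k) : Prop :=
  exists c r, occurrence S T c r.

Definition shapeD : grid_shape 3 3 :=
  [set~ (ord0, ord_max)] :\ (ord_max, ord0).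

Definition D_free w h (S : grid_shape w h) : Prop := ~ contains S shapeD.

Definition cell w h (S : grid_shape w h) := {x : 'I_w * 'I_h | x \in S}.

Definition filling w h (S : grid_shape w h) := {ffun cell S -> nat}.

(* In an occurrence, every cell x of T has exactly one corresponding cell y
   of S. *)
Definition fcontains w h l k (S : grid_shape w h) (T : grid_shape l k)
    (phiS : filling S) (phiT : filling T) : Prop :=
  exists c r, occurrence S T c r /\
    forall (x : cell T) (y : cell S),
      val y = (c (val x).1, r (val x).2) -> phiT x <= phiS y.

Definition favoids w h l k (S : grid_shape w h) (T : grid_shape l k)
    (phiS : filling S) (phiT : filling T) : Prop := ~ fcontains phiS phiT.

Definition square k : grid_shape k k := [set: 'I_k * 'I_k].

Definition iota_fill k : filling (square k) :=
  [ffun x : cell (square k) => ((val x).1 == (val x).2 : nat)].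

(* (i, k + 1 - i) in 1-based coordinates is i + j + 1 = k in 0-based ones. *)
Definition delta_fill k : filling (square k) :=
  [ffun x : cell (square k) => (((val x).1 + (val x).2).+1 == k : nat)].

Definition row_sum w h (S : grid_shape w h) (phi : filling S) (j : 'I_h) : nat :=
  \sum_(x : cell S | (val x).2 == j) phi x.

Definition col_sum w h (S : grid_shape w h) (phi : filling S) (i : 'I_w) : nat :=
  \sum_(x : cell S | (val x).1 == i) phi x.

(* Main.v *)
(* The permutations rho and sigma can be taken to be identities: for fixed row
   and column sums, as many fillings avoid delta_k as avoid iota_k, for every k,
   and fillings with prescribed margins can then be matched according to the
   length of their longest chain.

   In a D-free skew shape, either all the columns meeting the bottom row are
   equal, or all the rows meeting the leftmost column are.  Up to transposition,
   remove the bottom row and use induction.  To put the row back, let type A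
   crystal operators act on the columns it meets, reading the rows in the
   direction of the chains.  They preserve the margins of the other columns and
   the longest chain, both with and without the bottom row.  Evaluating
   alternants by a sign-reversing involution shows that the numbers of elements
   of each content (their column sums) determine the numbers of Yamanouchi
   elements of each content, and conversely.  In a Yamanouchi filling of the
   larger shape, whether there is a chain of length k through the bottom row
   depends on the content only.  So equal numbers without the bottom row yield
   equal numbers with it. *)

(* The two kinds of chains call for two crystal structures on the same fillings, one for each
   reading order, and the proof uses no map that intertwines them. All that they share is the
   content, and alternants see nothing else; this is why only counts are compared. Equality of the
   columns met by the bottom row is what allows a unit to move sideways: a chain needs its whole
   square of cells inside the shape, so the new cell must satisfy the membership conditions of the
   old one. In a Yamanouchi filling, the nonzero columns among these form an initial segment, and
   every nonzero entry in them ends a chain with one cell in each column up to its own. A chain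
   through the bottom row cannot leave these columns. So, when no chain of length [k + 1] avoids the
   bottom row, one exists if and only if the column numbered [k], counting from 0, is nonzero. *)
Require Import Defs.
From mathcomp Require Import all_boot all_order all_algebra all_fingroup.
From mathcomp Require Import finmap.
From mathcomp Require Import zify.

Set Implicit Arguments.
Unset Strict Implicit.
Unset Printing Implicit Defensive.

Import GRing.Theory Num.Theory.

(** * Bracketings *)

(* A pair (x, y) stands for y closing brackets followed by x opening ones;
   nclose and nopen count the unmatched brackets of each kind. *)
Fixpoint nclose (s : seq (nat * nat)) : nat :=
  if s is p :: s' then p.2 + (nclose s' - p.1) else 0.

Fixpoint nopen (s : seq (nat * nat)) : nat :=
  if s is p :: s' then nopen s' + (p.1 - nclose s') else 0.

(** Turns the leftmost unmatched opening bracket into a closing one. The name refers to [nclose]: on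
    two columns this becomes the lowering operator. *)
Fixpoint raise (s : seq (nat * nat)) : seq (nat * nat) :=
  if s is p :: s' then
    if nclose s' < p.1 then (p.1.-1, p.2.+1) :: s' else p :: raise s'
  else [::].

Fixpoint lower (s : seq (nat * nat)) : seq (nat * nat) :=
  if s is p :: s' then
    if p.1 < nclose s' then p :: lower s' else (p.1.+1, p.2.-1) :: s'
  else [::].

Lemma size_raise s : size (raise s) = size s.
Proof. by elim: s => //= p s IHs; case: ifP => //= _; rewrite IHs. Qed.

Lemma size_lower s : size (lower s) = size s.
Proof. by elim: s => //= p s IHs; case: ifP => //= _; rewrite IHs. Qed.

(** Both sides count the matched pairs once and all unmatched brackets once. *)
Lemma nclose_nopen s : sumn (map fst s) + nclose s = sumn (map snd s) + nopen s.
Proof. by elim: s => //= p s IHs; lia. Qed.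

Lemma nclose_raise s : 0 < nopen s -> nclose (raise s) = (nclose s).+1.
Proof.
elim: s => //= p s IHs; case: ifP => /= [lt_p _|/negbT]; first by lia.
by rewrite -leqNgt => le_p phi_gt0; rewrite IHs; lia.
Qed.

Lemma nclose_lower s : 0 < nclose s -> nclose s = (nclose (lower s)).+1.
Proof.
elim: s => //= p s IHs; case: ifP => /= [lt_p _|/negbT]; last by lia.
by have := IHs ltac:(lia); lia.
Qed.

Lemma nopen_lower s : 0 < nclose s -> nopen (lower s) = (nopen s).+1.
Proof.
elim: s => //= p s IHs; case: ifP => /= [lt_p _|/negbT]; last by lia.
by have := IHs ltac:(lia); have := @nclose_lower s ltac:(lia); lia.
Qed.

Lemma raiseK s : 0 < nopen s -> lower (raise s) = s.
Proof.
elim: s => //= -[x y] s IHs /=; case: ifP => /= [lt_p _|/negbT].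
  have /negbTE->: ~~ (x.-1 < nclose s) by lia.
  by congr ((_, _) :: _); lia.
rewrite -leqNgt => le_p phi_gt0; have phi_s: 0 < nopen s by lia.
by rewrite IHs // nclose_raise // ltnS le_p.
Qed.

Lemma lowerK s : 0 < nclose s -> raise (lower s) = s.
Proof.
elim: s => //= -[x y] s IHs /=; case: ifP => /= [lt_p _|/negbT].
  have eps_s: 0 < nclose s by lia.
  by rewrite IHs // ifN //; have := nclose_lower eps_s; lia.
rewrite -leqNgt => le_p y_gt0; rewrite ltnS le_p.
by congr ((_, _) :: _); lia.
Qed.

Lemma sum_ord_recl (F : nat -> nat) p :
  \sum_(i < p.+1) F i = F 0 + \sum_(i < p) F i.+1.
Proof. by rewrite big_ord_recl. Qed.

(** [nclose] is the largest excess of closing over opening brackets in a prefix. The number [m]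
    stands for opening brackets placed in front; the induction accumulates there those of the pairs
    already passed. *)
Lemma nclose_gtP m s :
  reflect (exists2 p, p < size s &
             m + \sum_(i < p) (nth (0, 0) s i).1
               < \sum_(i < p.+1) (nth (0, 0) s i).2)
          (m < nclose s).
Proof.
apply: (iffP idP) => [|[p lt_p]].
  elim: s m => //= -[x y] s IHs m /= lt_m.
  case: (ltnP m y) => [lt_my|le_ym].
    by exists 0 => //; rewrite big_ord0 big_ord1 /=; lia.
  have [p lt_p lt_s] := IHs (x + (m - y)) ltac:(lia).
  exists p.+1 => //.
  rewrite (sum_ord_recl (fun i => (nth (0, 0) _ i).1)).
  by rewrite (sum_ord_recl (fun i => (nth (0, 0) _ i).2)) /=; lia.
elim: s m p lt_p => //= -[x y] s IHs m [|p] lt_p.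
  by rewrite big_ord0 big_ord1 /=; lia.
rewrite (sum_ord_recl (fun i => (nth (0, 0) _ i).1)).
rewrite (sum_ord_recl (fun i => (nth (0, 0) _ i).2)) /= => lt_s.
case: (ltnP m y) => [|le_ym]; first by lia.
by have := IHs (x + (m - y)) p ltac:(lia) ltac:(lia); lia.
Qed.

(** An opening bracket to the left of the leftmost unmatched one has its partner before that one; if
    [y = 0], the partner lies in [s1]. *)
Lemma raiseE s : 0 < nopen s ->
  exists s1 x y s2, [/\ s = s1 ++ (x.+1, y) :: s2,
    raise s = s1 ++ (x, y.+1) :: s2, nclose s2 <= x
    & y = 0 -> forall q, q < size s1 -> 0 < (nth (0, 0) s q).1 ->
      exists2 q', q < q' < size s1 & 0 < (nth (0, 0) s q').2].
Proof.
elim: s => //= -[x y] s IHs /=; case: (ltnP (nclose s) x) => [|le_x phi_gt0].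
  by case: x => // x lt_x _; exists [::], x, y, s; split.
have [s1 [x' [y' [s2 [def_s def_f le_x' s1P]]]]] := IHs ltac:(lia).
exists ((x, y) :: s1), x', y', s2.
split=> //= [||y0 [|q] //= ltqs x_gt0]; rewrite -?def_s -?def_f //.
  suff [q lt_q ?]: exists2 q, q < size s1 & 0 < (nth (0, 0) s q).2.
    by exists q.+1.
  (* The pair [(x'.+1, 0)] absorbs every closing bracket of [s2], so one left unmatched in [s] comes
     from [s1]. *)
  have: 0 < nclose s by lia.
  rewrite def_s y0; clear -le_x'; elim: s1 => /= [|[a c] s1 IHs1] /=.
    by lia.
  case: c => [|c] le_x; last by exists 0.
  by have [q lt_q ?] := IHs1 ltac:(lia); exists q.+1.
by have [q' lt_q' ?] := s1P y0 q ltqs x_gt0; exists q'.+1.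
Qed.

(** Within a pair the closing brackets come first, so the partner of a closing bracket lies in a
    strictly earlier pair. *)
Lemma nclose0_before s i : nclose s = 0 -> 0 < (nth (0, 0) s i).2 ->
  exists2 k, k < i & 0 < (nth (0, 0) s k).1.
Proof.
elim: s i => [|[x y] s IHs] [|i] //=; first by lia.
case: x => [|x] eps_s y_gt0; last by exists 0.
by have [k lt_k ?] := IHs i ltac:(lia) y_gt0; exists k.+1.
Qed.

(** * Crystals and alternants *)

Definition lo n (j : 'I_n) : 'I_n.+1 := widen_ord (leqnSn n) j.
Definition hi n (j : 'I_n) : 'I_n.+1 := lift ord0 j.

Lemma lo_neq_hi n (j : 'I_n) : lo j != hi j.
Proof. by rewrite -val_eqE /= /bump /= add1n neq_ltn ltnSn. Qed.

(* String data of a type A crystal: ceps and cphi count the applications of the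
   raising operator ce and of the lowering operator cf that remain possible.
   The colour viol x of the first violation of the Yamanouchi condition matters
   only through its invariance along truncated strings, viol_cf. *)
Record crystal (n : nat) (X : eqType) := Crystal {
  ct : X -> {ffun 'I_n.+1 -> nat};
  ceps : 'I_n -> X -> nat;
  cphi : 'I_n -> X -> nat;
  cf : 'I_n -> X -> X;
  ce : 'I_n -> X -> X;
  viol : X -> option 'I_n;
  ct_ceps : forall j x, ct x (lo j) + ceps j x = ct x (hi j) + cphi j x;
  cfK : forall j x, 0 < cphi j x -> ce j (cf j x) = x;
  ceK : forall j x, 0 < ceps j x -> cf j (ce j x) = x;
  ceps_cf : forall j x, 0 < cphi j x -> ceps j (cf j x) = (ceps j x).+1;
  cphi_ce : forall j x, 0 < ceps j x -> cphi j (ce j x) = (cphi j x).+1;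
  ct_cf_lo : forall j x, 0 < cphi j x -> (ct (cf j x) (lo j)).+1 = ct x (lo j);
  ct_cf_hi : forall j x, 0 < cphi j x -> ct (cf j x) (hi j) = (ct x (hi j)).+1;
  ct_cf : forall j x i, 0 < cphi j x -> i != lo j -> i != hi j ->
    ct (cf j x) i = ct x i;
  viol_None : forall j x, viol x = None -> ceps j x = 0;
  viol_Some : forall j x, viol x = Some j -> 0 < ceps j x;
  viol_cf : forall j x, 0 < ceps j x -> 0 < cphi j x ->
    (viol (cf j x) == Some j) = (viol x == Some j)
}.

Section CrystalTheory.

Variables (n : nat) (X : eqType) (C : crystal n X).
Implicit Types (j : 'I_n) (x y : X) (D P : pred X) (nu : {ffun 'I_n.+1 -> nat}).

Definition crystal_closed D := forall j x, 0 < cphi C j x -> D (cf C j x) = D x.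

Definition yam x := viol C x == None.

Lemma cphi_cf j x : 0 < cphi C j x -> (cphi C j (cf C j x)).+1 = cphi C j x.
Proof.
move=> x_gt0; have := ct_ceps C j (cf C j x); have := ct_ceps C j x.
by have := ct_cf_lo x_gt0; rewrite ceps_cf // ct_cf_hi //; lia.
Qed.

(** Compares two points of a [j]-string that are [m] steps apart, so that both branches of
    [creflect] can be treated alike. The premise of [shift_viol] keeps away from the top of the
    string, where [ceps] vanishes. *)
Record shift j m x y := Shift {
  shift_f : y = iter m (cf C j) x;
  shift_e : x = iter m (ce C j) y;
  shift_ceps : ceps C j y = ceps C j x + m;
  shift_cphi : cphi C j x = cphi C j y + m;
  shift_lo : ct C x (lo j) = ct C y (lo j) + m;
  shift_hi : ct C y (hi j) = ct C x (hi j) + m;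
  shift_ct : forall i, i != lo j -> i != hi j -> ct C y i = ct C x i;
  shift_closed : forall D, crystal_closed D -> D x = D y;
  shift_viol : 0 < ceps C j x -> (viol C x == Some j) = (viol C y == Some j)
}.

Lemma shift_iter_f j m x : m <= cphi C j x -> shift j m x (iter m (cf C j) x).
Proof.
elim: m => [_|m IHm lt_m]; first by split=> //=; rewrite addn0.
case: (IHm (ltnW lt_m)); set y := iter m _ x => yE xE epsE phiE loE hiE ctE DE JE.
have y_gt0 : 0 < cphi C j y by lia.
have := cphi_cf y_gt0; have := ct_cf_lo y_gt0; rewrite iterS -/y => loE' phiE'.
change (shift j m.+1 x (cf C j y)).
split; rewrite ?ceps_cf ?ct_cf_hi //; try lia.
- by rewrite iterSr cfK.
- by move=> i ilo ihi; rewrite ct_cf // ctE.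
- by move=> D Dcl; rewrite Dcl // DE.
- by move=> x_gt0; rewrite viol_cf ?JE //; lia.
Qed.

Lemma shift_iter_e j m y : m <= ceps C j y -> shift j m (iter m (ce C j) y) y.
Proof.
move=> le_m; have : m <= cphi C j (iter m (ce C j) y) /\
    iter m (cf C j) (iter m (ce C j) y) = y.
  suff [-> [le_phi]]: iter m (cf C j) (iter m (ce C j) y) = y /\
      m <= cphi C j (iter m (ce C j) y) /\
      ceps C j (iter m (ce C j) y) + m = ceps C j y by [].
  elim: m le_m => [_|m IHm lt_m] //=; first by rewrite addn0.
  have [fK [le_phi eps_m]] := IHm (ltnW lt_m).
  have e_gt0: 0 < ceps C j (iter m (ce C j) y) by lia.
  rewrite -iterS iterSr ceK // fK cphi_ce //; split=> //; split=> //.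
  have := @ceps_cf _ _ C j (ce C j (iter m (ce C j) y)).
  by rewrite ceK // cphi_ce //; lia.
by case=> /shift_iter_f + yE; rewrite yE.
Qed.

(* The point of the j-string of x with the roles of ceps and cphi exchanged;
   for a = 1 the string is first deprived of its top element. *)
Definition creflect (a : bool) j x :=
  if ceps C j x <= cphi C j x + a
  then iter (cphi C j x + a - ceps C j x) (cf C j) x
  else iter (ceps C j x - (cphi C j x + a)) (ce C j) x.

Lemma creflect_shift (a : bool) j x : a <= ceps C j x ->
  exists m, (ceps C j x + m = cphi C j x + a /\ shift j m x (creflect a j x)) \/
            (ceps C j x = cphi C j x + a + m /\ shift j m (creflect a j x) x).
Proof.
move=> le_a; rewrite /creflect; case: leqP => le_eps.
  exists (cphi C j x + a - ceps C j x); left.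
  by split; [lia | apply: shift_iter_f; lia].
exists (ceps C j x - (cphi C j x + a)); right.
by split; [lia | apply: shift_iter_e; lia].
Qed.

Section Reflect.

Variables (a : bool) (j : 'I_n) (x : X).
Hypothesis le_a : a <= ceps C j x.
Let y := creflect a j x.

Lemma ceps_creflect : ceps C j y = cphi C j x + a.
Proof. by rewrite /y; case: (creflect_shift le_a) => m [] [? []] *; lia. Qed.

Lemma cphi_creflect : cphi C j y + a = ceps C j x.
Proof. by rewrite /y; case: (creflect_shift le_a) => m [] [? []] *; lia. Qed.

Lemma creflectK : creflect a j y = x.
Proof.
rewrite {1}/creflect ceps_creflect cphi_creflect /y /creflect.
case: (ltngtP (ceps C j x) (cphi C j x + a)) => [lt_eps|gt_eps|eq_eps].
- set m := cphi C j x + a - ceps C j x.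
  have /shift_iter_f/shift_e <- // : m <= cphi C j x by lia.
- set m := ceps C j x - (cphi C j x + a).
  have /shift_iter_e/shift_f <- // : m <= ceps C j x by lia.
by rewrite eq_eps subnn.
Qed.

(** For [a = true] the content undergoes the dot action: once [(n, ..., 1, 0)] is added to it, the
    entries at [lo j] and [hi j] are exchanged. For [a = false] they are exchanged as they stand. *)
Lemma ct_creflect_lo : ct C y (lo j) + a = ct C x (hi j).
Proof.
have := ct_ceps C j x; have := ct_ceps C j y.
have := ceps_creflect; have := cphi_creflect; rewrite /y.
by case: (creflect_shift le_a) => m [] [? []] *; lia.
Qed.

Lemma ct_creflect_hi : ct C y (hi j) = ct C x (lo j) + a.
Proof.
have := ct_ceps C j x; have := ct_ceps C j y.
have := ceps_creflect; have := cphi_creflect; rewrite /y.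
by case: (creflect_shift le_a) => m [] [? []] *; lia.
Qed.

Lemma ct_creflect i : i != lo j -> i != hi j -> ct C y i = ct C x i.
Proof.
move=> ilo ihi; case: (creflect_shift le_a) => m [] [_ sh].
  by rewrite (shift_ct sh).
by rewrite -(shift_ct sh).
Qed.

Lemma closed_creflect D : crystal_closed D -> D y = D x.
Proof.
move=> clD; case: (creflect_shift le_a) => m [] [_ sh].
  by rewrite (shift_closed sh clD).
by rewrite -(shift_closed sh clD).
Qed.

Lemma viol_creflect : a -> (viol C y == Some j) = (viol C x == Some j).
Proof.
move=> a1; have eps_x : 0 < ceps C j x by case: (a) a1 le_a.
have eps_y : 0 < ceps C j y by rewrite ceps_creflect a1 addn1.
case: (creflect_shift le_a) => m [] [_ sh].
  by rewrite (shift_viol sh).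
by rewrite -(shift_viol sh).
Qed.

End Reflect.
End CrystalTheory.

Lemma perm_filter_bij (X : eqType) (E F : seq X) (P Q : pred X) (h h' : X -> X) :
    uniq E -> uniq F ->
    (forall x, P x -> x \in E) -> (forall x, Q x -> x \in F) ->
    (forall x, P x -> Q (h x) /\ h' (h x) = x) ->
    (forall x, Q x -> P (h' x) /\ h (h' x) = x) ->
  perm_eq (map h (filter P E)) (filter Q F).
Proof.
move=> uE uF sP sQ hP hQ; apply/uniq_perm; rewrite ?filter_uniq //.
  rewrite map_inj_in_uniq ?filter_uniq // => x y.
  rewrite !mem_filter => /andP[/hP[_ xK] _] /andP[/hP[_ yK] _] eq_h.
  by rewrite -xK eq_h yK.
move=> y; rewrite mem_filter; apply/mapP/andP => [[x + ->]|[Qy _]].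
  by rewrite mem_filter => /andP[/hP[Qhx _] _]; split=> //; apply: sQ.
have [Phy yK] := hQ y Qy.
by exists (h' y); rewrite ?yK // mem_filter Phy sP.
Qed.

Lemma count_bij (X : eqType) (E F : seq X) (P Q : pred X) (h h' : X -> X) :
    uniq E -> uniq F ->
    (forall x, P x -> x \in E) -> (forall x, Q x -> x \in F) ->
    (forall x, P x -> Q (h x) /\ h' (h x) = x) ->
    (forall x, Q x -> P (h' x) /\ h (h' x) = x) ->
  count P E = count Q F.
Proof.
move=> uE uF sP sQ hP hQ; rewrite -!size_filter -(size_map h).
by apply: perm_size; apply: perm_filter_bij hP hQ.
Qed.

(** A fixed point of [h] is harmless, since an integer equal to its own negative is zero. *)
Lemma sum_antisym0 (X : eqType) (E : seq X) (P : pred X) (h : X -> X)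
    (F : X -> int) :
    uniq E -> (forall x, P x -> x \in E) ->
    (forall x, P x -> P (h x) /\ h (h x) = x) ->
    (forall x, P x -> F (h x) = - F x)%R ->
  (\sum_(x <- E | P x) F x = 0)%R.
Proof.
move=> uE sP hP hF; have hE := perm_filter_bij uE uE sP sP hP hP.
suff: (\sum_(x <- E | P x) F x = - \sum_(x <- E | P x) F x)%R by lia.
rewrite -{1}big_filter -(perm_big _ hE) big_map big_filter -sumrN.
by apply: eq_bigr => x /hF.
Qed.

(** * Alternants as a triangular system on contents *)

Section Alternant.

Variable n : nat.
Implicit Types (lam nu : {ffun 'I_n.+1 -> nat}).

Definition partition_like nu := [forall j : 'I_n, nu (hi j) <= nu (lo j)].

Lemma partition_likeP nu (i k : 'I_n.+1) :
  partition_like nu -> i <= k -> nu k <= nu i.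
Proof.
move=> /forallP pnu; case: k => k; elim: k => [|k IHk] lt_k /= le_ik.
  by have -> : i = Ordinal lt_k by apply/val_inj => /=; lia.
move: le_ik; rewrite leq_eqVlt => /predU1P[eq_i|lt_ik].
  by have -> : i = Ordinal lt_k by apply/val_inj.
have lt_kn : k < n by lia.
apply: leq_trans (IHk (ltnW lt_k) lt_ik); have := pnu (Ordinal lt_kn).
by congr (nu _ <= nu _); apply/val_inj.
Qed.

(* The coefficient of x ^ (lam + rho) in the alternant of nu + rho, with
   rho = (n, ..., 1, 0). *)
Definition alternant lam nu : int :=
  (\det (\matrix_(i < n.+1, k < n.+1) ((nu i + k == lam k + i)%N)%:R))%R.

(** The dot action exchanges two rows of the matrix. *)
Lemma alternant_dot lam nu nu' (j : 'I_n) :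
    nu' (lo j) + 1 = nu (hi j) -> nu' (hi j) = nu (lo j) + 1 ->
    (forall i, i != lo j -> i != hi j -> nu' i = nu i) ->
  (alternant lam nu' = - alternant lam nu)%R.
Proof.
move=> nu_lo nu_hi nu_ne; rewrite /alternant.
set A := (X in (_ = - \det X)%R); set B := (X in (\det X = _)%R).
have -> : B = xrow (lo j) (hi j) A.
  apply/matrixP => i k; rewrite !mxE; congr (_%:R)%R; congr (nat_of_bool _).
  case: tpermP => [->|->|/eqP ilo /eqP ihi]; last by rewrite nu_ne.
    by rewrite /= /bump /=; lia.
  by rewrite /= /bump /=; lia.
rewrite xrowE det_mulmx det_perm odd_tperm lo_neq_hi expr1 mulN1r.
by [].
Qed.

Lemma alternant_neq0 lam nu : (alternant lam nu != 0)%R ->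
  exists s : 'S_n.+1, forall i, nu i + s i = lam (s i) + i.
Proof.
move=> nz; case: (pickP (fun s : 'S_n.+1 => [forall i, nu i + s i == lam (s i) + i])).
  by move=> s /forallP sP; exists s => i; apply/eqP.
move=> no_s; case/eqP: nz; rewrite /alternant /determinant big1 // => s _.
have /negbT := no_s s; rewrite negb_forall => /existsP[i ne_i].
by rewrite (bigD1 i) //= mxE (negPf ne_i) mul0r mulr0.
Qed.

(** Adding the staircase makes the parts strictly decreasing, which leaves only zeros above the
    diagonal. *)
Lemma alternant_diag lam : partition_like lam -> alternant lam lam = 1%R.
Proof.
move=> plam; rewrite /alternant det_trig; last first.
  apply/is_trig_mxP => i k lt_ik; rewrite mxE.
  have := partition_likeP plam (ltnW lt_ik).
  by case: eqP => //; lia.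
by rewrite big1 // => i _; rewrite mxE eqxx.
Qed.

(* The base exceeds the number of parts, so that a single larger part outweighs
   all the parts it dominates. *)
Definition weight nu := \sum_i n.+2 ^ nu i.

(** The weight replaces the dominance order because it is also invariant under permutation of the
    parts, on which [sort_partition] relies. *)
Lemma weight_dominance lam nu (s : 'S_n.+1) :
    partition_like lam -> (forall i, nu i + s i = lam (s i) + i) ->
  nu = lam \/ weight lam < weight nu.
Proof.
move=> plam nuE; case: (pickP (fun i => s i != i)) => [i1 ne_i1|s_id]; last first.
  by left; apply/ffunP => i; move: (nuE i); rewrite (eqP (negbFE (s_id i))) => /addIn.
right; have [i0 ne_i0 min_i0] := @arg_minnP _ i1 (fun i => s i != i) (@nat_of_ord n.+1) ne_i1.
have s_lt (i : 'I_n.+1) : i < i0 -> s i = i.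
  by move=> lt_i; apply/eqP; apply: contraLR lt_i => /min_i0; rewrite -leqNgt.
(* [l] is the index sent to the first moved index [i0]. It lies to the right of [i0], so its part
   must exceed [lam i0]. *)
pose l := (s^-1 i0)%g; have sl : s l = i0 by rewrite permKV.
have lt_l : i0 < l.
  rewrite ltnNge leq_eqVlt; apply/negP => /orP[/eqP/val_inj el|/s_lt].
    by move: ne_i0; rewrite -{1}el sl eqxx.
  by move=> el; move: ne_i0; rewrite -[i0]sl el el eqxx.
have nu_l : lam i0 < nu l by have := nuE l; rewrite sl; lia.
rewrite /weight (bigID (fun i : 'I__ => i < i0)) /=.
rewrite [X in _ < X](bigID (fun i : 'I__ => i < i0)) /=.
have -> : \sum_(i < n.+1 | i < i0) n.+2 ^ nu i = \sum_(i < n.+1 | i < i0) n.+2 ^ lam i.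
  by apply: eq_bigr => i lt_i; have := nuE i; rewrite s_lt // => /addIn ->.
rewrite ltn_add2l [X in _ < X](bigD1 l) /=; last by rewrite -leqNgt ltnW.
apply: leq_trans (leq_addr _ _).
(* The parts of [lam] from [i0] on are at most [lam i0], and there are fewer than [n.+2] of them. *)
apply: (@leq_ltn_trans (\sum_(i < n.+1) n.+2 ^ lam i0)).
  rewrite [X in _ <= X](bigID (fun i : 'I__ => i < i0)) /=.
  apply: leq_trans (leq_addl _ _); apply: leq_sum => i; rewrite -leqNgt => le_i.
  by rewrite leq_pexp2l // partition_likeP.
rewrite sum_nat_const card_ord.
apply: (@leq_trans (n.+2 ^ (lam i0).+1)); last by rewrite leq_pexp2l.
by rewrite expnS ltn_mul2r expn_gt0 /=.
Qed.

Lemma alternant_weight lam nu : partition_like lam ->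
  (alternant lam nu != 0)%R -> nu = lam \/ weight lam < weight nu.
Proof. by move=> plam /alternant_neq0[s sP]; apply: weight_dominance sP. Qed.

(** For distinct partitions a nonzero value would force a strict inequality of weights, and the
    inverse permutation the opposite one. *)
Lemma alternant_partition lam nu : partition_like lam -> partition_like nu ->
  alternant lam nu = ((nu == lam)%:R)%R.
Proof.
move=> plam pnu; case: eqP => [->|ne]; first exact: alternant_diag.
apply/eqP/idPn => nz.
have [|lt1] := alternant_weight plam nz; first by [].
have [s sP] := alternant_neq0 nz.
have [//|/esym//|] := @weight_dominance nu lam s^-1 pnu.
  by move=> i; have := sP (s^-1 i)%g; rewrite permKV => <-; rewrite addnC.
by rewrite ltnNge ltnW.
Qed.

Definition swap_adj (j : 'I_n) nu : {ffun 'I_n.+1 -> nat} :=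
  [ffun i => nu (tperm (lo j) (hi j) i)].

Lemma weight_swap j nu : weight (swap_adj j nu) = weight nu.
Proof.
rewrite /weight [RHS](reindex_inj (@perm_inj _ (tperm (lo j) (hi j)))) /=.
by apply: eq_bigr => i _; rewrite ffunE.
Qed.

Lemma sort_partition (R : eqType) (F : {ffun 'I_n.+1 -> nat} -> R) nu :
    (forall j kap, F (swap_adj j kap) = F kap) ->
  exists lam, [/\ partition_like lam, weight lam = weight nu & F lam = F nu].
Proof.
(* Exchanging an ascent brings the larger part to the smaller index, which lowers [m]. *)
move=> Fsw; pose m kap := \sum_(i < n.+1) i * (kap : {ffun _ -> nat}) i.
have [k le_k] := ubnP (m nu); elim: k nu le_k => // k IHk nu /ltnSE le_k.
case: (boolP (partition_like nu)) => [pnu|]; first by exists nu.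
rewrite negb_forall => /existsP[j]; rewrite -ltnNge => lt_j.
have [|lam [plam wlam Flam]] := IHk (swap_adj j nu).
  apply: leq_trans le_k.
  have mE kap : m kap = lo j * kap (lo j) + (hi j * kap (hi j)
      + \sum_(i < n.+1 | (i != lo j) && (i != hi j)) i * kap i).
    by rewrite /m (bigD1 (lo j)) //= (bigD1 (hi j)) //= eq_sym lo_neq_hi.
  rewrite !mE !ffunE tpermL tpermR.
  have -> : \sum_(i < n.+1 | (i != lo j) && (i != hi j)) i * swap_adj j nu i
          = \sum_(i < n.+1 | (i != lo j) && (i != hi j)) i * nu i.
    by apply: eq_bigr => i /andP[ilo ihi]; rewrite ffunE tpermD // eq_sym.
  have hiE : hi j = (lo j).+1 :> nat by rewrite /= /bump leq0n.
  by rewrite addnA [X in _ < X]addnA ltn_add2r hiE;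
     move: (nat_of_ord (lo j)) (nu (lo j)) (nu (hi j)) lt_j => u a c; nia.
by exists lam; rewrite plam wlam weight_swap Flam Fsw.
Qed.

(** Descending induction on the weight, started by the finite support. In the sum for a partition
    [lam], every other content with a nonzero alternant is heavier, so only [F lam] remains;
    symmetry passes from partitions to all contents. *)
Lemma symmetric_eq0 (F : {ffun 'I_n.+1 -> nat} -> int)
    (r : seq {ffun 'I_n.+1 -> nat}) :
    uniq r -> (forall nu, F nu != 0%R -> nu \in r) ->
    (forall j nu, F (swap_adj j nu) = F nu) ->
    (forall lam, partition_like lam ->
       \sum_(nu <- r) F nu * alternant lam nu = 0)%R ->
  forall nu, F nu = 0%R.
Proof.
move=> ur rF Fsw Falt nu; pose b := \sum_(kap <- r) weight kap.
have wb kap : b < weight kap -> F kap = 0%R.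
  move=> lt_b; apply/eqP/idPn => /rF r_kap; move: lt_b.
  by rewrite /b (bigD1_seq kap) //= ltnNge leq_addr.
suff Fm m kap : b < weight kap + m -> F kap = 0%R by apply: (Fm b.+1); lia.
elim: m kap => [|m IHm] kap lt_m; first by apply: wb; rewrite addn0 in lt_m.
have [lam [plam wlam <-]] := sort_partition kap Fsw.
case: (boolP (lam \in r)) => [r_lam|]; last first.
  by move=> nr; apply/eqP/idPn => /rF; rewrite (negPf nr).
have := Falt lam plam; rewrite (bigD1_seq lam) //= alternant_diag // mulr1.
rewrite big1_seq ?addr0 // => kap' /andP[ne_kap _].
case: (eqVneq (alternant lam kap') 0%R) => [->|]; first by rewrite mulr0.
move=> /(alternant_weight plam)[/eqP|lt_w]; first by rewrite (negPf ne_kap).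
by rewrite IHm ?mul0r //; lia.
Qed.

End Alternant.

Lemma yam_partition n (X : eqType) (C : crystal n X) x :
  yam C x -> partition_like (ct C x).
Proof.
move=> /eqP vx; apply/forallP => j; have := ct_ceps C j x.
by rewrite (viol_None j vx); lia.
Qed.

(** * Counting the elements of a crystal by content *)

Section CrystalCount.

Variables (n : nat) (X : eqType) (C : crystal n X) (E : seq X) (D : pred X).
Hypotheses (uE : uniq E) (sD : forall x, D x -> x \in E).
Hypothesis clD : crystal_closed C D.

Definition ct_count nu := count (fun x => D x && (ct C x == nu)) E.

(** Reflecting the full [j]-strings exchanges two entries of the content and stays inside closed
    predicates. *)
Lemma ct_count_swap j nu : ct_count (swap_adj j nu) = ct_count nu.
Proof.
have swK kap : swap_adj j (swap_adj j kap) = kap.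
  by apply/ffunP => i; rewrite !ffunE tpermK.
have ct_refl x : ct C (creflect C false j x) = swap_adj j (ct C x).
  apply/ffunP => i; rewrite ffunE.
  have lo_ := @ct_creflect_lo _ _ C false j x isT.
  have hi_ := @ct_creflect_hi _ _ C false j x isT.
  rewrite !addn0 in lo_ hi_.
  case: tpermP => [->|->|/eqP ilo /eqP ihi] //.
  exact: (@ct_creflect _ _ C false j x).
have reflK x : creflect C false j (creflect C false j x) = x.
  exact: (@creflectK _ _ C false j x).
have D_refl x : D (creflect C false j x) = D x.
  exact: (@closed_creflect _ _ C false j x isT D clD).
apply: (@count_bij _ _ _ _ _ (creflect C false j) (creflect C false j)) => // x.
- by case/andP => /sD.
- by case/andP => /sD.
- by case/andP=> Dx /eqP ctx; rewrite D_refl Dx ct_refl ctx swK eqxx.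
- by case/andP=> Dx /eqP ctx; rewrite D_refl Dx ct_refl ctx eqxx.
Qed.

(* Reflecting an element that is not Yamanouchi in the string of its first
   violation negates its alternant. *)
Lemma sum_alternant lam :
  (\sum_(x <- E | D x) alternant lam (ct C x)
   = \sum_(x <- E | D x && yam C x) alternant lam (ct C x))%R.
Proof.
rewrite (bigID (yam C)) /= [X in (_ + X)%R](_ : _ = 0)%R ?addr0 //.
pose h x := if viol C x is Some j then creflect C true j x else x.
have hP x j : viol C x = Some j ->
    [/\ h x = creflect C true j x, 0 < ceps C j x & viol C (h x) = Some j].
  move=> vx; have eps_gt0 := viol_Some vx; rewrite /h vx; split=> //.
  by apply/eqP; rewrite (@viol_creflect _ _ C true) // vx.
apply: (@sum_antisym0 _ _ _ h) => //.
- by move=> x /andP[/sD].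
- move=> x /andP[Dx]; rewrite /yam; case vx: (viol C x) => [j|] // _.
  have [hx eps_gt0 vhx] := hP x j vx; rewrite vhx andbT {2}/h vhx hx.
  by rewrite (@closed_creflect _ _ C true j x) // (@creflectK _ _ C true).
- move=> x /andP[Dx]; rewrite /yam; case vx: (viol C x) => [j|] // _.
  have [hx eps_gt0 vhx] := hP x j vx; rewrite hx.
  apply: (@alternant_dot _ _ _ _ j); first exact: (@ct_creflect_lo _ _ C true).
    exact: (@ct_creflect_hi _ _ C true).
  exact: (@ct_creflect _ _ C true j x).
Qed.

Lemma sum_alternant_yam lam : partition_like lam ->
  (\sum_(x <- E | D x) alternant lam (ct C x)
   = (count (fun x => [&& D x, yam C x & ct C x == lam]) E)%:R)%R.
Proof.
move=> plam; rewrite sum_alternant -sum1_count natr_sum /= big_mkcond.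
rewrite [RHS]big_mkcond /=; apply: eq_bigr => x _.
case Dx: (D x) => //=; case yx: (yam C x) => //=.
by rewrite alternant_partition ?yam_partition //; case: eqP.
Qed.

Lemma sum_ct_count (F : {ffun 'I_n.+1 -> nat} -> int) r :
    uniq r -> (forall x, D x -> ct C x \in r) ->
  (\sum_(x <- E | D x) F (ct C x) = \sum_(nu <- r) (ct_count nu)%:R * F nu)%R.
Proof.
move=> ur rD; transitivity (\sum_(x <- E | D x)
    \sum_(nu <- r) (ct C x == nu)%:R * F nu)%R.
  apply: eq_bigr => x /rD r_x; rewrite (bigD1_seq (ct C x)) //= eqxx mul1r.
  rewrite big1 ?addr0 // => nu; rewrite eq_sym => /negPf ->.
  by rewrite mul0r.
rewrite exchange_big /=; apply: eq_bigr => nu _; rewrite -mulr_suml.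
congr (_ * _)%R; rewrite /ct_count -sum1_count natr_sum big_mkcondr /=.
by apply: eq_bigr => x _; case: eqP.
Qed.

End CrystalCount.

(* The counts by content determine the numbers of Yamanouchi elements of each
   content, and conversely. *)
Theorem crystal_transfer n (X : eqType) (C1 C2 : crystal n X) (E : seq X)
    (D1 D2 P1 P2 : pred X) (ok : pred {ffun 'I_n.+1 -> nat}) :
    uniq E ->
    (forall x, D1 x -> x \in E) -> (forall x, D2 x -> x \in E) ->
    crystal_closed C1 D1 -> crystal_closed C2 D2 ->
    crystal_closed C1 P1 -> crystal_closed C2 P2 ->
    (forall x, D1 x -> yam C1 x -> P1 x = ok (ct C1 x)) ->
    (forall x, D2 x -> yam C2 x -> P2 x = ok (ct C2 x)) ->
    ct_count C1 E D1 =1 ct_count C2 E D2 ->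
  ct_count C1 E (predI D1 P1) =1 ct_count C2 E (predI D2 P2).
Proof.
move=> uE sD1 sD2 clD1 clD2 clP1 clP2 okP1 okP2 eqD.
have clDP (C : crystal n X) (D P : pred X) : crystal_closed C D -> crystal_closed C P ->
    crystal_closed C (predI D P).
  by move=> clD clP j x x_gt0 /=; rewrite clD ?clP.
have sDP (D P : pred X) : (forall x, D x -> x \in E) ->
    forall x, predI D P x -> x \in E.
  by move=> sD x /andP[/sD].
(* A finite list of contents outside of which all counts vanish. *)
pose r := undup (map (ct C1) E ++ map (ct C2) E).
have ur : uniq r by apply: undup_uniq.
have r1 (D : pred X) : (forall x, D x -> x \in E) -> forall x, D x -> ct C1 x \in r.
  by move=> sD x /sD Ex; rewrite mem_undup mem_cat map_f.
have r2 (D : pred X) : (forall x, D x -> x \in E) -> forall x, D x -> ct C2 x \in r.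
  by move=> sD x /sD Ex; rewrite mem_undup mem_cat orbC map_f.
have eq_yam lam : partition_like lam ->
    count (fun x => [&& D1 x, yam C1 x & ct C1 x == lam]) E
    = count (fun x => [&& D2 x, yam C2 x & ct C2 x == lam]) E.
  move=> plam; have := sum_alternant_yam uE sD1 clD1 plam.
  rewrite (sum_ct_count _ _ ur (r1 _ sD1)); under eq_bigr do rewrite eqD.
  rewrite -(sum_ct_count _ _ ur (r2 _ sD2)) sum_alternant_yam //.
  by move=> /eqP; rewrite eqr_nat => /eqP.
(* Among the Yamanouchi elements of content [lam], [P] holds for all or for none, according to
   [ok lam]. *)
have yamDP C (D P : pred X) lam :
    (forall x, D x -> yam C x -> P x = ok (ct C x)) ->
    count (fun x => [&& predI D P x, yam C x & ct C x == lam]) E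
    = ok lam * count (fun x => [&& D x, yam C x & ct C x == lam]) E.
  move=> okP; case okl: (ok lam); rewrite ?mul1n ?mul0n.
    apply: eq_count => x /=; case Dx: (D x); case yx: (yam C x);
      rewrite ?andbF //= okP //.
    by case: eqP => [->|]; rewrite ?okl ?andbF ?andbT.
  apply/eqP; rewrite -leqn0 leqNgt -has_count; apply/hasPn => x _ /=.
  case Dx: (D x); case yx: (yam C x); rewrite ?andbF //= okP //.
  by case: eqP => [->|]; rewrite ?okl ?andbF.
(* This difference is symmetric and supported in [r]; equality of the Yamanouchi counts makes its
   sum against every alternant of a partition vanish. *)
pose F nu : int := ((ct_count C1 E (predI D1 P1) nu)%:R
                    - (ct_count C2 E (predI D2 P2) nu)%:R)%R.
suff F0 : forall nu, F nu = 0%R.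
  by move=> nu; have /eqP := F0 nu; rewrite subr_eq0 eqr_nat => /eqP.
apply: (@symmetric_eq0 _ _ r) => //.
- move=> nu; apply: contraR => nr; rewrite /F /ct_count.
  have cnt0 (C : crystal n X) (D : pred X) :
      {subset map (ct C) E <= r} -> count (fun x => D x && (ct C x == nu)) E = 0.
    move=> sr; apply/eqP; rewrite -leqn0 leqNgt -has_count; apply/hasPn => x Ex.
    by apply/negP => /andP[_ /eqP ctx]; case/negP: nr; rewrite -ctx sr ?map_f.
  by rewrite !cnt0 // => kap; rewrite mem_undup mem_cat => ->; rewrite ?orbT.
- move=> j nu; rewrite /F !ct_count_swap //; by [apply: clDP|apply: sDP].
move=> lam plam; under eq_bigr do rewrite /F mulrBl.
rewrite sumrB -(sum_ct_count _ _ ur (r1 _ (sDP _ _ sD1))).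
rewrite -(sum_ct_count _ _ ur (r2 _ (sDP _ _ sD2))).
rewrite !sum_alternant_yam //; try by [apply: clDP|apply: sDP].
by rewrite (yamDP C1) // (yamDP C2) // eq_yam // subrr.
Qed.

(** * The crystal on two-dimensional fillings *)

Section FirstViolation.

Variables (m n : nat) (V : nat -> 'I_n -> bool).

(* Violations are ordered by increasing row p, then by decreasing colour. *)
Definition is_first_viol (j : 'I_n) :=
  [exists p : 'I_m.+1, V p j &&
    [forall p' : 'I_m.+1, forall i : 'I_n,
      V p' i ==> (p < p') || ((p == p') && (i <= j))]].

Definition first_viol := [pick j | is_first_viol j].

(** Whether [j] comes first depends only on the rows before [p] and, in row [p], on larger colours.
    The lowering operator of colour [j], acting in row [p] or later, changes none of these
    violations; hence the decreasing order of colours. *)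
Lemma is_first_violE p j : p <= m -> V p j -> (forall p', p' < p -> ~~ V p' j) ->
  is_first_viol j =
    [forall p' : 'I_m.+1, forall i : 'I_n,
       (p' < p) || ((p' == p :> nat) && (j < i)) ==> ~~ V p' i].
Proof.
rewrite -ltnS => le_p Vp min_p; apply/existsP/forallP.
  case=> q /andP[Vq /forallP qP] p'; apply/forallP => i; apply/implyP => p'P.
  have q_p : q = p :> nat.
    apply/eqP; rewrite eqn_leq; apply/andP; split.
      have /forallP/(_ j)/implyP := qP (Ordinal le_p).
      by rewrite Vp => /(_ isT); rewrite -val_eqE /=; lia.
    by rewrite leqNgt; apply: contraL Vq => /min_p.
  apply/negP => Vi; have /forallP/(_ i) := qP p'; rewrite Vi /=.
  by rewrite -val_eqE /= q_p; lia.
move=> pP; exists (Ordinal le_p); rewrite Vp; apply/forallP => p'.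
apply/forallP => i; apply/implyP; apply: contraLR => np.
have /forallP/(_ i)/implyP := pP p'; apply.
by move: np; rewrite -val_eqE /=; lia.
Qed.

Lemma is_first_viol_inj j j' : is_first_viol j -> is_first_viol j' -> j = j'.
Proof.
move=> /existsP[p /andP[Vp /forallP pP]] /existsP[p' /andP[Vp' /forallP p'P]].
have /forallP/(_ j')/implyP/(_ Vp') := pP p'.
have /forallP/(_ j)/implyP/(_ Vp) := p'P p.
by rewrite -!val_eqE /= => ? ?; apply/val_inj => /=; lia.
Qed.

Lemma first_viol_Some j : (first_viol == Some j) = is_first_viol j.
Proof.
rewrite /first_viol; case: pickP => [i iP|/(_ j) -> //].
apply/eqP/idP => [[<-] //|jP]; congr Some; exact: is_first_viol_inj.
Qed.

Lemma first_viol_None p j : p <= m -> first_viol = None -> V p j = false.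
Proof.
rewrite /first_viol; case: pickP => // no_first.
rewrite -ltnS => le_p _; apply/negP => Vp.
pose W (c : 'I_m.+1 * 'I_n) := V c.1 c.2.
have Wp : W (Ordinal le_p, j) by [].
(* The lexicographic order in a single number: [n - c.2] stays below [n.+1]. *)
have [[q i] Wq min_q] := arg_minnP (fun c : 'I_m.+1 * 'I_n => c.1 * n.+1 + (n - c.2)) Wp.
have /negbT/negP := no_first i; apply; apply/existsP; exists q.
apply/andP; split=> //; apply/forallP => q'; apply/forallP => i'; apply/implyP.
move=> Vq'; have := min_q (q', i') Vq'; rewrite /= -val_eqE /=.
case: (ltngtP q q') => //= [lt_q|eq_q].
  have : q'.+1 * n.+1 <= q * n.+1 by rewrite leq_mul2r lt_q orbT.
  by rewrite mulSn; lia.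
rewrite eq_q leq_add2l; have := ltn_ord i; have := ltn_ord i'; lia.
Qed.

End FirstViolation.

Section Board.

Variable M : nat.

(** One square type serves all shapes, so that transposing or removing a row does not change the
    type. Shapes are separate predicates on [nat]. *)
Definition board := {ffun 'I_M.+1 * 'I_M.+1 -> nat}.

Implicit Types (phi : board) (b : bool).

(* The entry in column x and row y, zero outside the board. *)
Definition entry phi x y :=
  if (x <= M) && (y <= M) then phi (inord x, inord y) else 0.

Definition mkboard (g : nat -> nat -> nat) : board :=
  [ffun p : 'I_M.+1 * 'I_M.+1 => g p.1 p.2].

Lemma entry_mkboard g x y : x <= M -> y <= M -> entry (mkboard g) x y = g x y.
Proof. by move=> lex ley; rewrite /entry lex ley ffunE !inordK. Qed.

Lemma entry_inj phi psi :
  (forall x y, x <= M -> y <= M -> entry phi x y = entry psi x y) -> phi = psi.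
Proof.
move=> eq_e; apply/ffunP => -[x y]; have := eq_e x y.
by rewrite /entry !leq_ord /= !inord_val; apply.
Qed.

Lemma entry_gt0 phi x y : 0 < entry phi x y -> (x <= M) && (y <= M).
Proof. by rewrite /entry; case: ifP. Qed.

(* The i-th row in reading order: a chain meets the rows from top to bottom if
   b (SE chains), from bottom to top otherwise (NE chains). *)
Definition read b i := if b then M - i else i.

Lemma read_le b i : i <= M -> read b i <= M.
Proof. by case: b => //= _; apply: leq_subr. Qed.

Lemma readK b i : i <= M -> read b (read b i) = i.
Proof. by case: b => //=; apply: subKn. Qed.

(** The guard matters for [b = true], where truncated subtraction would send every index beyond [M]
    to row 0. *)
Definition rentry b phi x i := if i <= M then entry phi x (read b i) else 0.

Lemma entry_read b phi x y : y <= M -> entry phi x y = rentry b phi x (read b y).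
Proof. by move=> ley; rewrite /rentry read_le ?readK. Qed.

Lemma rentry_gt0 b phi x i : 0 < rentry b phi x i -> (x <= M) && (i <= M).
Proof.
by rewrite /rentry; case: ifP => // lei /entry_gt0/andP[-> _].
Qed.

Lemma rentry_inj b phi psi :
    (forall x i, x <= M -> i <= M -> rentry b phi x i = rentry b psi x i) ->
  phi = psi.
Proof.
move=> eq_r; apply: entry_inj => x y lex ley.
by rewrite !(entry_read b) ?eq_r ?read_le.
Qed.

(** Column [c] holds opening brackets and column [c.+1] closing ones. As the closing ones come first
    in each row, partners always lie in different rows, as do the cells of a chain. *)
Definition two_cols b phi c :=
  mkseq (fun i => (rentry b phi c i, rentry b phi c.+1 i)) M.+1.

Definition set_two_cols b phi c (s : seq (nat * nat)) : board :=
  mkboard (fun x y => if x == c then (nth (0, 0) s (read b y)).1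
                      else if x == c.+1 then (nth (0, 0) s (read b y)).2
                      else entry phi x y).

Lemma rentry_set_two_cols b phi c s x i : x <= M -> i <= M ->
  rentry b (set_two_cols b phi c s) x i =
    if x == c then (nth (0, 0) s i).1
    else if x == c.+1 then (nth (0, 0) s i).2 else rentry b phi x i.
Proof.
by move=> lex lei; rewrite /rentry lei entry_mkboard ?read_le ?readK.
Qed.

Lemma nth_two_cols b phi c i : i <= M ->
  nth (0, 0) (two_cols b phi c) i = (rentry b phi c i, rentry b phi c.+1 i).
Proof. by move=> lei; rewrite nth_mkseq. Qed.

Lemma two_colsK b phi c : set_two_cols b phi c (two_cols b phi c) = phi.
Proof.
apply: (@rentry_inj b) => x i lex lei.
rewrite rentry_set_two_cols // nth_two_cols //.
by case: eqP => [->|_] //; case: eqP => [->|_].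
Qed.

Lemma set_two_colsK b phi c s : c < M -> size s = M.+1 ->
  two_cols b (set_two_cols b phi c s) c = s.
Proof.
move=> lt_c sz_s; apply: (@eq_from_nth _ (0, 0)) => [|i]; rewrite size_mkseq //.
rewrite ltnS => lei; rewrite nth_two_cols // !rentry_set_two_cols ?(ltnW lt_c) //.
by rewrite eqxx eqn_leq ltnn /= eqxx -surjective_pairing.
Qed.

Lemma set_set_two_cols b phi c s t :
  set_two_cols b (set_two_cols b phi c s) c t = set_two_cols b phi c t.
Proof.
apply: (@rentry_inj b) => x i lex lei; rewrite !rentry_set_two_cols //.
by case: eqP => // _; case: eqP.
Qed.

Definition colsum phi x := \sum_(y < M.+1) entry phi x y.
Definition rowsum phi y := \sum_(x < M.+1) entry phi x y.

Lemma colsumE b phi x : colsum phi x = \sum_(i < M.+1) rentry b phi x i.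
Proof.
have read_lt (i : 'I_M.+1) : read b i < M.+1 by rewrite ltnS read_le ?leq_ord.
rewrite /colsum (reindex_inj (h := fun i => Ordinal (read_lt i))).
  by apply: eq_bigr => i _; rewrite /rentry leq_ord.
move=> i i' /(congr1 (fun k : 'I_M.+1 => read b k)) /=.
by rewrite !readK ?leq_ord // => /val_inj.
Qed.

Lemma sumn_two_cols b phi c :
  (sumn (map fst (two_cols b phi c)) = colsum phi c) *
  (sumn (map snd (two_cols b phi c)) = colsum phi c.+1).
Proof.
rewrite !(colsumE b) /two_cols /mkseq -!map_comp !sumnE !big_map.
by rewrite -[iota 0 _]/(index_iota 0 M.+1) !big_mkord.
Qed.

Definition fcol b c phi := set_two_cols b phi c (raise (two_cols b phi c)).
Definition ecol b c phi := set_two_cols b phi c (lower (two_cols b phi c)).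
Definition epscol b c phi := nclose (two_cols b phi c).
Definition phicol b c phi := nopen (two_cols b phi c).

Lemma colsum_eps_phi b c phi :
  colsum phi c + epscol b c phi = colsum phi c.+1 + phicol b c phi.
Proof.
have [<- <-] := sumn_two_cols b phi c; exact: nclose_nopen.
Qed.

Lemma two_cols_fcol b c phi : c < M ->
  two_cols b (fcol b c phi) c = raise (two_cols b phi c).
Proof. by move=> lt_c; rewrite set_two_colsK // size_raise size_mkseq. Qed.

Lemma two_cols_ecol b c phi : c < M ->
  two_cols b (ecol b c phi) c = lower (two_cols b phi c).
Proof. by move=> lt_c; rewrite set_two_colsK // size_lower size_mkseq. Qed.

(* The Yamanouchi condition for columns c and c.+1 fails in row p. *)
Definition overfull b phi p c :=
  \sum_(i < p) rentry b phi c i < \sum_(i < p.+1) rentry b phi c.+1 i.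

Lemma epscol_gt0 b c phi :
  reflect (exists2 p, p <= M & overfull b phi p c) (0 < epscol b c phi).
Proof.
have sumE q : q <= M.+1 ->
    (\sum_(i < q) (nth (0, 0) (two_cols b phi c) i).1
       = \sum_(i < q) rentry b phi c i) *
    (\sum_(i < q) (nth (0, 0) (two_cols b phi c) i).2
       = \sum_(i < q) rentry b phi c.+1 i).
  by move=> leq; split; apply: eq_bigr => i _; rewrite nth_two_cols //;
     have := ltn_ord i; lia.
apply: (iffP (nclose_gtP _ _)) => [] [p]; rewrite ?size_mkseq.
  by rewrite ltnS => lep; rewrite !sumE ?(leqW lep) //; exists p.
by move=> lep pP; exists p; rewrite ?size_mkseq // !sumE ?(leqW lep).
Qed.

(** Here [q] is the row in which a unit moves from column [c] to [c.+1]. [step_before] and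
    [step_after] provide a substitute cell when the move makes [(c.+1, q)] nonzero or [(c, q)] zero.
    By [step_overfull], the first violation between the two columns, if any, does not come after row
    [q]. *)
Record fcol_step b c phi q : Prop := FcolStep {
  step_le : q <= M;
  step_gt0 : 0 < rentry b phi c q;
  step_rentry : forall x i, x <= M -> i <= M ->
    rentry b (fcol b c phi) x i =
      if i == q then
        if x == c then (rentry b phi x i).-1
        else if x == c.+1 then (rentry b phi x i).+1 else rentry b phi x i
      else rentry b phi x i;
  step_before : rentry b phi c.+1 q = 0 ->
    forall p, p < q -> 0 < rentry b phi c p ->
    exists2 p', p < p' < q & 0 < rentry b phi c.+1 p';
  step_after : rentry b phi c q = 1 ->
    forall p, q < p <= M -> 0 < rentry b phi c.+1 p ->
    exists2 p', q < p' < p & 0 < rentry b phi c p';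
  step_overfull : forall p, q < p <= M -> overfull b phi p c -> overfull b phi q c
}.

Lemma fcolP b c phi : c < M -> 0 < phicol b c phi -> exists q, fcol_step b c phi q.
Proof.
move=> lt_c /raiseE[s1 [x [y [s2 [def_s def_f eps_s2 s1P]]]]].
have sz_s : size s1 + (size s2).+1 = M.+1.
  by rewrite -[RHS](size_mkseq (fun i => (rentry b phi c i, rentry b phi c.+1 i)))
             -/(two_cols b phi c) def_s size_cat.
have leq : size s1 <= M by lia.
have colE i : i <= M ->
    (rentry b phi c i, rentry b phi c.+1 i) = nth (0, 0) (two_cols b phi c) i.
  by move=> lei; rewrite nth_two_cols.
have [cq c1q] : rentry b phi c (size s1) = x.+1 /\ rentry b phi c.+1 (size s1) = y.
  by have := colE _ leq; rewrite def_s nth_cat ltnn subnn /= => -[-> ->].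
have s2E i : i < size s2 ->
    nth (0, 0) s2 i = (rentry b phi c ((size s1).+1 + i), rentry b phi c.+1 ((size s1).+1 + i)).
  move=> lt_i; rewrite colE; last by lia.
  by rewrite def_s nth_cat ifN ?addSn -?addnS ?addKn //; lia.
exists (size s1); split=> //.
- by rewrite cq.
- move=> x' i lex lei; rewrite rentry_set_two_cols // def_f nth_cat.
  have := colE i lei; rewrite def_s nth_cat.
  case: (ltngtP i (size s1)) => [lt_i|lt_i|->] /=.
  + by case: eqP => [->|_]; [|case: eqP => [->|_]]; [move=> <-|move=> <-|].
  + have [i' ->] : exists i', i - size s1 = i'.+1 by exists (i - size s1).-1; lia.
    by rewrite /=; case: eqP => [->|_]; [|case: eqP => [->|_]]; [move=> <-|move=> <-|].
  + by rewrite subnn /=; case: eqP => [->|_]; [|case: eqP => [->|_]];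
      [case=> -> _|case=> _ ->|].
- rewrite c1q => y0 p lt_p p_gt0; have [|p' lt_p'] := s1P y0 p lt_p.
    by rewrite -colE //; lia.
  by rewrite -colE; [exists p'|lia].
(* A single opening bracket in row [q] means that no closing bracket of [s2] is unmatched. *)
- rewrite cq => -[x0] p /andP[lt_p lep] p_gt0.
  have [||k lt_k k_gt0] := @nclose0_before s2 (p - (size s1).+1).
  + by lia.
  + by rewrite s2E ?subnKC //=; lia.
  by exists ((size s1).+1 + k); [lia|move: k_gt0; rewrite s2E //; lia].
(* After row [q] the closing brackets gain at most [x] over the opening ones, while row [q] itself
   has [x.+1] opening ones. So an excess in row [p] was already present in row [q]. *)
- move=> p /andP[lt_p lep]; rewrite /overfull.
  have sum_s2 (F : nat -> nat) k :
      \sum_(i < (size s1).+1 + k) F i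
      = \sum_(i < (size s1).+1) F i + \sum_(i < k) F ((size s1).+1 + i).
    by rewrite big_split_ord.
  have [k def_p] : exists k, p = (size s1).+1 + k by exists (p - (size s1).+1); lia.
  rewrite {p}def_p in lt_p lep *; rewrite -addnS !sum_s2 => ltF.
  rewrite -ltnS; apply: contraTltn eps_s2 => le_q; rewrite -ltnNge.
  apply/nclose_gtP; exists k; first by lia.
  have s2E1 : \sum_(i < k) (nth (0, 0) s2 i).1
            = \sum_(i < k) rentry b phi c ((size s1).+1 + i).
    by apply: eq_bigr => i _; rewrite s2E //; have := ltn_ord i; lia.
  have s2E2 : \sum_(i < k.+1) (nth (0, 0) s2 i).2
            = \sum_(i < k.+1) rentry b phi c.+1 ((size s1).+1 + i).
    by apply: eq_bigr => i _; rewrite s2E //; have := ltn_ord i; lia.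
  rewrite s2E1 s2E2; move: ltF le_q.
  rewrite [\sum_(i < (size s1).+1) rentry b phi c i]big_ord_recr /= cq; lia.
Qed.

End Board.

(** * The operators on neighbouring columns form a crystal *)

Section ColumnCrystal.

Variable M : nat.
Implicit Types (phi : board M) (b : bool).

Lemma colsum_fcol b c phi : c < M -> 0 < phicol b c phi ->
  [/\ (colsum (fcol b c phi) c).+1 = colsum phi c,
      colsum (fcol b c phi) c.+1 = (colsum phi c.+1).+1
    & forall x, x <= M -> x != c -> x != c.+1 ->
        colsum (fcol b c phi) x = colsum phi x].
Proof.
move=> lt_c phi_gt0; split; last first.
- move=> x lex /negPf nec /negPf nec1; rewrite !(colsumE b).
  by apply: eq_bigr => i _; rewrite rentry_set_two_cols ?leq_ord // nec nec1.
- have [_ <-] := sumn_two_cols b (fcol b c phi) c.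
  have [_ <-] := sumn_two_cols b phi c; rewrite two_cols_fcol //.
  have [s1 [x [y [s2 [-> -> _ _]]]]] := raiseE phi_gt0.
  by rewrite !map_cat !sumn_cat /= addnA addnS addnA.
- have [<- _] := sumn_two_cols b (fcol b c phi) c.
  have [<- _] := sumn_two_cols b phi c; rewrite two_cols_fcol //.
  have [s1 [x [y [s2 [-> -> _ _]]]]] := raiseE phi_gt0.
  by rewrite !map_cat !sumn_cat /= addSn addnS.
Qed.

Lemma fcolK b c phi : c < M -> 0 < phicol b c phi -> ecol b c (fcol b c phi) = phi.
Proof.
move=> lt_c phi_gt0; rewrite /ecol two_cols_fcol // raiseK //.
by rewrite /fcol set_set_two_cols two_colsK.
Qed.

Lemma ecolK b c phi : c < M -> 0 < epscol b c phi -> fcol b c (ecol b c phi) = phi.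
Proof.
move=> lt_c eps_gt0; rewrite /fcol two_cols_ecol // lowerK //.
by rewrite /ecol set_set_two_cols two_colsK.
Qed.

(** In row [q], larger colours are safe: the condition for [c.+1] involves column [c.+1] only in
    rows strictly before [q], while the other columns it involves do not change. *)
Lemma overfull_fcol b c phi q p c' : fcol_step b c phi q -> c < M -> c' < M ->
  (p < q) || ((p == q) && (c < c')) ->
  overfull b (fcol b c phi) p c' = overfull b phi p c'.
Proof.
move=> st lt_c lt_c' le_pq; have le_q := step_le st.
have sumE x m : x <= M -> (m <= q) || ((m == q.+1) && (c.+1 < x)) ->
    \sum_(i < m) rentry b (fcol b c phi) x i = \sum_(i < m) rentry b phi x i.
  move=> lex lem; apply: eq_bigr => i _; have lt_i := ltn_ord i.
  rewrite (step_rentry st) //; last by lia.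
  case: eqP => // iq; rewrite !ifN //; lia.
by rewrite /overfull !sumE //; lia.
Qed.

Lemma overfull_fcol_same b c phi q : fcol_step b c phi q -> c < M ->
  overfull b phi q c -> overfull b (fcol b c phi) q c.
Proof.
move=> st lt_c; rewrite /overfull => lt_sum; have le_q := step_le st.
have -> : \sum_(i < q) rentry b (fcol b c phi) c i = \sum_(i < q) rentry b phi c i.
  apply: eq_bigr => i _; have lt_i := ltn_ord i.
  by rewrite (step_rentry st) ?ifN //; lia.
apply: leq_trans lt_sum _; apply: leq_sum => i _; have lt_i := ltn_ord i.
rewrite (step_rentry st) //; last by lia.
by case: eqP => // _; rewrite ifN ?eqxx //; lia.
Qed.

Section Instance.

Variables (b : bool) (x0 n : nat).
Hypothesis le_n : x0 + n <= M.

Let lt_col (j : 'I_n) : x0 + j < M.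
Proof. by have := ltn_ord j; lia. Qed.

Definition col_content phi : {ffun 'I_n.+1 -> nat} :=
  [ffun i : 'I_n.+1 => colsum phi (x0 + i)].

Definition col_viol phi : option 'I_n :=
  first_viol M (fun p j => overfull b phi p (x0 + j)).

Lemma col_content_hi phi (j : 'I_n) :
  col_content phi (hi j) = colsum phi (x0 + j).+1.
Proof. by rewrite ffunE /= /bump leq0n add1n addnS. Qed.

Lemma col_content_lo phi (j : 'I_n) : col_content phi (lo j) = colsum phi (x0 + j).
Proof. by rewrite ffunE. Qed.

(** The first row violating colour [j] is not after the row of the move. It therefore remains the
    first such row, and the violations that could precede it are unaffected. *)
Lemma col_viol_fcol phi (j : 'I_n) : 0 < epscol b (x0 + j) phi ->
  0 < phicol b (x0 + j) phi ->
  (col_viol (fcol b (x0 + j) phi) == Some j) = (col_viol phi == Some j).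
Proof.
move=> /epscol_gt0 ex_p phi_gt0; rewrite !first_viol_Some.
have [q st] := fcolP (lt_col j) phi_gt0.
have le_q := step_le st.
pose V p := (p <= M) && overfull b phi p (x0 + j).
have exV : exists p, V p by case: ex_p => p lep pP; exists p; rewrite /V lep.
case: (ex_minnP exV) => p /andP[lep Vp] min_p.
have minV p' : p' < p -> ~~ overfull b phi p' (x0 + j).
  move=> lt_p; apply: contraL lt_p => Vp'; rewrite -leqNgt.
  case: (leqP p' M) => [lep'|]; last by move/ltnW/(leq_trans lep).
  by apply: min_p; rewrite /V lep'.
have le_pq : p <= q.
  rewrite leqNgt; apply/negP => lt_q; case/negP: (minV q lt_q).
  by apply: (step_overfull st) Vp; rewrite lt_q.
rewrite (@is_first_violE _ _ (fun p j => overfull b phi p (x0 + j)) p) //.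
rewrite (@is_first_violE _ _ (fun p i => overfull b (fcol b (x0 + j) phi) p (x0 + i)) p) //.
- apply: eq_forallb => p'; apply: eq_forallb => i.
  case: (boolP ((p' < p) || _)) => //= p'P.
  by rewrite (overfull_fcol st) //; lia.
- move: le_pq; rewrite leq_eqVlt => /predU1P[eq_p|lt_p].
    by rewrite eq_p; apply: overfull_fcol_same => //; rewrite -eq_p.
  by rewrite (overfull_fcol st) // lt_p.
- move=> p' lt_p'; rewrite (overfull_fcol st) ?minV //.
  by rewrite (leq_trans lt_p').
Qed.

(** The columns involved are [x0, ..., x0 + n]. The definition is transparent so that its fields
    reduce to the column operators. *)
Definition col_crystal : crystal n (board M).
Proof.
apply: (@Crystal n (board M) col_content
  (fun j => epscol b (x0 + j)) (fun j => phicol b (x0 + j))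
  (fun j => fcol b (x0 + j)) (fun j => ecol b (x0 + j)) col_viol).
- by move=> j phi; rewrite col_content_hi col_content_lo (colsum_eps_phi b).
- by move=> j phi; apply: fcolK.
- by move=> j phi; apply: ecolK.
- by move=> j phi gt0; rewrite /epscol two_cols_fcol // nclose_raise.
- by move=> j phi gt0; rewrite /phicol two_cols_ecol // nopen_lower.
- by move=> j phi gt0; rewrite !col_content_lo; case: (colsum_fcol (lt_col j) gt0).
- by move=> j phi gt0; rewrite !col_content_hi; case: (colsum_fcol (lt_col j) gt0).
- move=> j phi i gt0 nelo nehi; rewrite !ffunE.
  case: (colsum_fcol (lt_col j) gt0) => _ _ -> //.
  + by have := ltn_ord i; lia.
  + by apply: contraNneq nelo => /addnI e; apply/eqP/val_inj.
  + apply: contraNneq nehi => e; apply/eqP/val_inj => /=.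
    by move: e; rewrite -addnS => /addnI; rewrite /bump leq0n.
- move=> j phi viol0; apply/eqP; rewrite -leqn0 leqNgt; apply/negP.
  case/epscol_gt0 => p lep pP.
  by have := first_viol_None j lep viol0; rewrite pP.
- move=> j phi /eqP; rewrite first_viol_Some => /existsP[p /andP[pP _]].
  by apply/epscol_gt0; exists p; rewrite ?leq_ord.
- by move=> j phi; apply: col_viol_fcol.
Defined.

End Instance.

Lemma rowsum_fcol b c phi y : c < M -> 0 < phicol b c phi -> y <= M ->
  rowsum (fcol b c phi) y = rowsum phi y.
Proof.
move=> lt_c gt0 ley; have [q st] := fcolP lt_c gt0.
have rowE (psi : board M) : rowsum psi y = \sum_(x < M.+1) rentry b psi x (read M b y).
  by apply: eq_bigr => x _; rewrite (entry_read b).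
rewrite !rowE; case: (eqVneq (read M b y) q) => [eq_q|ne_q]; last first.
  apply: eq_bigr => x _; rewrite (step_rentry st) ?leq_ord ?read_le //.
  by rewrite (negPf ne_q).
have lt_cM : c < M.+1 := ltnW lt_c.
have ne_c : Ordinal (lt_c : c.+1 < M.+1) != Ordinal lt_cM.
  by rewrite -val_eqE /= neq_ltn ltnSn orbT.
have sumE (F : 'I_M.+1 -> nat) : \sum_x F x = F (Ordinal lt_cM)
    + (F (Ordinal (lt_c : c.+1 < M.+1)) +
       \sum_(x | (x != Ordinal lt_cM) && (x != Ordinal (lt_c : c.+1 < M.+1))) F x).
  by rewrite (bigD1 (Ordinal lt_cM)) //= (bigD1 (Ordinal (lt_c : c.+1 < M.+1))).
rewrite !sumE eq_q !(step_rentry st) ?(step_le st) ?(ltnW lt_c) // !eqxx.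
rewrite [c.+1 == c]eqn_leq ltnn /=.
have -> : \sum_(x < M.+1 | (x != Ordinal lt_cM) && (x != Ordinal (lt_c : c.+1 < M.+1)))
            rentry b (fcol b c phi) x q
        = \sum_(x < M.+1 | (x != Ordinal lt_cM) && (x != Ordinal (lt_c : c.+1 < M.+1)))
            rentry b phi x q.
  apply: eq_bigr => x; rewrite -!val_eqE /= => /andP[/negPf nec /negPf nec1].
  by rewrite (step_rentry st) ?leq_ord ?(step_le st) // eqxx nec nec1.
by case: (rentry b phi c q) (step_gt0 st) => // m _; rewrite /= !addSn addnS.
Qed.

End ColumnCrystal.

(** * Chains *)

Section Chains.

Variable M : nat.
Implicit Types (phi psi : board M) (b : bool) (S : nat -> nat -> bool)
  (s : seq (nat * nat)) (p q : nat * nat).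

Definition lt2 p q := (p.1 < q.1) && (p.2 < q.2).

(* A chain is an unordered list of pairs (column, reading index). *)
Definition chain b S phi s :=
  [&& uniq s,
      all (fun p => all (fun q =>
        [|| p == q, lt2 p q | lt2 q p] && S p.1 (read M b q.2)) s) s
    & all (fun p => 0 < rentry b phi p.1 p.2) s].

Lemma chainP b S phi s :
  reflect [/\ uniq s,
              {in s &, forall p q, [|| p == q, lt2 p q | lt2 q p]},
              {in s &, forall p q, S p.1 (read M b q.2)}
            & {in s, forall p, 0 < rentry b phi p.1 p.2}]
          (chain b S phi s).
Proof.
apply: (iffP and3P) => [[us /allP sP /allP s_gt0]|[us s_lt sS s_gt0]].
  by split=> // p q /sP/allP pP /pP/andP[].
split=> //; apply/allP => // p ps; apply/allP => q qs.
by rewrite s_lt ?sS.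
Qed.

(** Tuples of board positions make this a boolean; no chain is missed, because nonzero entries lie
    on the board. *)
Definition avoids b S k phi :=
  ~~ [exists t : k.-tuple ('I_M.+1 * 'I_M.+1),
        chain b S phi [seq (val x.1, val x.2) | x <- t]].

Lemma avoidsP b S k phi :
  reflect (forall s, size s = k -> ~~ chain b S phi s) (avoids b S k phi).
Proof.
apply: (iffP idP) => [av s sz_s|av]; last first.
  by apply/existsP => -[t]; apply/negP/av; rewrite size_map size_tuple.
apply: contra av => ch_s; pose t := [seq (inord p.1, inord p.2) : 'I_M.+1 * 'I_M.+1 | p <- s].
have sz_t : size t == k by rewrite size_map sz_s.
apply/existsP; exists (Tuple sz_t) => /=; rewrite -map_comp map_id_in //.
case/chainP: ch_s => _ _ _ gt0 [x i] /gt0/rentry_gt0/= /andP[lex lei].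
by rewrite !inordK.
Qed.

Lemma chain_replace b S phi psi s p p' : chain b S phi s -> p \in s ->
    (forall q, q \in s -> q != p -> lt2 q p' || lt2 p' q) ->
    (forall q, q \in s -> S p'.1 (read M b q.2) && S q.1 (read M b p'.2)) ->
    S p'.1 (read M b p'.2) ->
    (forall q, q \in s -> q != p -> 0 < rentry b psi q.1 q.2) ->
    0 < rentry b psi p'.1 p'.2 ->
  chain b S psi (p' :: rem p s).
Proof.
move=> /chainP[us s_lt sS _] ps p'_lt p'S p'S' psi_gt0 psi_p'.
have remP q : q \in rem p s -> (q \in s) /\ (q != p).
  by rewrite mem_rem_uniq // inE => /andP[].
apply/chainP; split.
- rewrite /= rem_uniq // andbT; apply/negP => /remP[p's ne_p'].
  by have := p'_lt _ p's ne_p'; rewrite /lt2; lia.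
- move=> q r; rewrite !inE => /predU1P[->|/remP[qs ne_q]] /predU1P[->|/remP[rs ne_r]].
  + by rewrite eqxx.
  + by rewrite orbC orbC [X in _ || X]orbC p'_lt ?orbT.
  + by rewrite p'_lt ?orbT.
  + exact: s_lt.
- move=> q r; rewrite !inE => /predU1P[->|/remP[qs ne_q]] /predU1P[->|/remP[rs ne_r]] //.
  + by case/andP: (p'S r rs).
  + by case/andP: (p'S q qs).
  + exact: sS.
- by move=> q; rewrite !inE => /predU1P[->|/remP[qs ne_q]] //; apply: psi_gt0.
Qed.

Section Invariance.

Variables (b : bool) (S : nat -> nat -> bool) (c : nat).
Hypotheses (lt_c : c < M) (eqS : forall y, S c.+1 y = S c y).
Hypothesis col_conv : forall x y y' z, S x y -> S x y' -> y <= z <= y' -> S x z.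

Let S_between x i j k : i < j < k -> k <= M ->
  S x (read M b i) -> S x (read M b k) -> S x (read M b j).
Proof.
move=> ltj lek Si Sk; case: b Si Sk => /= Si Sk.
  by apply: (col_conv Sk Si); lia.
by apply: (col_conv Si Sk); lia.
Qed.

(** A chain is in danger only if it uses [(c, q)] and the entry there drops to zero. If it also uses
    column [c.+1], [step_after] gives a cell of column [c] in a row between the two; otherwise
    [(c, q)] is replaced by [(c.+1, q)]. *)
Lemma chain_fcol phi s : 0 < phicol b c phi -> chain b S phi s ->
  exists2 s', size s' = size s & chain b S (fcol b c phi) s'.
Proof.
move=> gt0 ch; have [q st] := fcolP lt_c gt0; have le_q := step_le st.
have [us s_lt sS s_gt0] := chainP _ _ _ _ ch.
have le_s p : p \in s -> (p.1 <= M) && (p.2 <= M) by move/s_gt0/rentry_gt0.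
have psi_gt0 p : p \in s -> p != (c, q) -> 0 < rentry b (fcol b c phi) p.1 p.2.
  move=> ps ne_p; have /andP[le1 le2] := le_s p ps; have := s_gt0 p ps.
  rewrite (step_rentry st) //; case: (eqVneq p.2 q) => // e2.
  case: (eqVneq p.1 c) => e1; last by case: eqP.
  by case/eqP: ne_p; rewrite -e1 -e2 -surjective_pairing.
have [cq|ncq] := boolP ((c, q) \in s); last first.
  exists s => //; apply/chainP; split=> // p ps; apply: psi_gt0 => //.
  by apply: contraNneq ncq => <-.
have [gt1|le1] := ltnP 1 (rentry b phi c q).
  exists s => //; apply/chainP; split=> // p ps.
  case: (eqVneq p (c, q)) => [->|]; last exact: psi_gt0.
  by rewrite (step_rentry st) //= ?eqxx; [lia|exact: ltnW].
have cq1 : rentry b phi c q = 1 by have := step_gt0 st; lia.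
have size_rep p' : size (p' :: rem (c, q) s) = size s.
  by rewrite /= size_rem // prednK //; case: (s) cq.
have cmp p : p \in s -> p != (c, q) -> lt2 p (c, q) \/ lt2 (c, q) p.
  by move=> ps ne_p; have := s_lt p (c, q) ps cq; rewrite (negPf ne_p) /= => /orP.
have [/hasP[[c1 p]]|/hasPn no_c1] := boolP (has (fun p => p.1 == c.+1) s).
  move=> ps /= /eqP c1E; rewrite {c1}c1E in ps.
  have ne_ps : (c.+1, p) != (c, q) by rewrite -pair_eqE /= eqn_leq ltnn.
  have [|/andP[_ /= lt_qp]] := cmp _ ps ne_ps; first by rewrite /lt2 /= ltnNge leqnSn.
  have /andP[_ /= lep] := le_s _ ps.
  have [||q' /andP[lt_q' lt_p'] q'_gt0] := step_after st cq1 (p := p).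
  + by rewrite lt_qp.
  + exact: (s_gt0 _ ps).
  exists ((c, q') :: rem (c, q) s) => //; apply: (chain_replace ch) => //=.
  + move=> r rs ne_r; case: (cmp r rs ne_r) => /andP[/= lt1 lt2r].
      by rewrite /lt2 /= lt1 (ltn_trans lt2r).
    have := s_lt r (c.+1, p) rs ps; rewrite /lt2 -pair_eqE /=; lia.
  + move=> r rs; rewrite (sS (c, q) r) //=.
    (* Row [q'] lies between two rows of the chain, so convexity of the columns keeps the grid
       inside the shape. *)
    by apply: (@S_between _ q q' p); rewrite ?lt_q' ?(sS r (c, q)) ?(sS r (c.+1, p)).
  + by apply: (@S_between _ q q' p); rewrite ?lt_q' ?(sS (c, q) (c, q)) ?(sS (c, q) (c.+1, p)).
  + by rewrite (step_rentry st) ?ifN //; lia.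
exists ((c.+1, q) :: rem (c, q) s) => //; apply: (chain_replace ch) => //=.
- move=> r rs ne_r; have := no_c1 r rs.
  by case: (cmp r rs ne_r); rewrite /lt2 /=; lia.
- by move=> r rs; rewrite eqS (sS (c, q) r) ?(sS r (c, q)).
- by rewrite eqS (sS (c, q) (c, q)).
- by rewrite (step_rentry st) // eqxx ifN ?eqxx //; lia.
Qed.

(** Dual to [chain_fcol]: the entry at [(c.+1, q)] may be due to the move alone. Then [step_before]
    gives a substitute in column [c.+1], or [(c, q)] itself serves if the chain does not use column
    [c]. *)
Lemma chain_fcol_inv phi s : 0 < phicol b c phi -> chain b S (fcol b c phi) s ->
  exists2 s', size s' = size s & chain b S phi s'.
Proof.
move=> gt0 ch; have [q st] := fcolP lt_c gt0; have le_q := step_le st.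
have [us s_lt sS s_gt0] := chainP _ _ _ _ ch.
have le_s p : p \in s -> (p.1 <= M) && (p.2 <= M) by move/s_gt0/rentry_gt0.
have phi_gt0 p : p \in s -> p != (c.+1, q) -> 0 < rentry b phi p.1 p.2.
  move=> ps ne_p; have /andP[le1 le2] := le_s p ps; have := s_gt0 p ps.
  rewrite (step_rentry st) //; case: (eqVneq p.2 q) => // e2.
  case: (eqVneq p.1 c) => e1; first by lia.
  case: (eqVneq p.1 c.+1) => // e1'.
  by case/eqP: ne_p; rewrite -e1' -e2 -surjective_pairing.
have [cq|ncq] := boolP ((c.+1, q) \in s); last first.
  exists s => //; apply/chainP; split=> // p ps; apply: phi_gt0 => //.
  by apply: contraNneq ncq => <-.
have [gt1|le1] := ltnP 0 (rentry b phi c.+1 q).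
  exists s => //; apply/chainP; split=> // p ps.
  by case: (eqVneq p (c.+1, q)) => [->|] //; exact: phi_gt0.
have cq1 : rentry b phi c.+1 q = 0 by lia.
have size_rep p' : size (p' :: rem (c.+1, q) s) = size s.
  by rewrite /= size_rem // prednK //; case: (s) cq.
have cmp p : p \in s -> p != (c.+1, q) -> lt2 p (c.+1, q) \/ lt2 (c.+1, q) p.
  by move=> ps ne_p; have := s_lt p (c.+1, q) ps cq; rewrite (negPf ne_p) /= => /orP.
have [/hasP[[c1 p]]|/hasPn no_c1] := boolP (has (fun p => p.1 == c) s).
  move=> ps /= /eqP c1E; rewrite {c1}c1E in ps.
  have ne_ps : (c, p) != (c.+1, q) by rewrite -pair_eqE /= eqn_leq ltnn andbF.
  have [/andP[_ /= lt_pq]|] := cmp _ ps ne_ps; last first.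
    by rewrite /lt2 /= ltnNge leqnSn.
  have [||q' /andP[lt_q' lt_p'] q'_gt0] := step_before st cq1 (p := p).
  + by [].
  + exact: (phi_gt0 _ ps).
  exists ((c.+1, q') :: rem (c.+1, q) s) => //; apply: (chain_replace ch) => //=.
  + move=> r rs ne_r; case: (cmp r rs ne_r) => /andP[/= lt1 lt2r]; last first.
      by rewrite /lt2 /= lt1 (ltn_trans _ lt2r) ?orbT.
    have := s_lt r (c, p) rs ps; rewrite /lt2 -pair_eqE /=; lia.
  + move=> r rs; rewrite (sS (c.+1, q) r) //=.
    by apply: (@S_between _ p q' q); rewrite ?lt_q' ?(sS r (c, p)) ?(sS r (c.+1, q)).
  + apply: (@S_between _ p q' q); rewrite ?lt_q' //.
      by rewrite (sS (c.+1, q) (c, p)).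
    by rewrite (sS (c.+1, q) (c.+1, q)).
exists ((c, q) :: rem (c.+1, q) s) => //; apply: (chain_replace ch) => //=.
- move=> r rs ne_r; have := no_c1 r rs.
  by case: (cmp r rs ne_r); rewrite /lt2 /=; lia.
- by move=> r rs; rewrite -eqS (sS (c.+1, q) r) ?(sS r (c.+1, q)).
- by rewrite -eqS (sS (c.+1, q) (c.+1, q)).
- exact: (step_gt0 st).
Qed.

Lemma avoids_fcol k phi : 0 < phicol b c phi ->
  avoids b S k (fcol b c phi) = avoids b S k phi.
Proof.
move=> gt0; apply/avoidsP/avoidsP => av s sz_s; apply/negP.
  by move/(chain_fcol gt0) => [s' sz_s']; apply/negP/av; rewrite sz_s'.
by move/(chain_fcol_inv gt0) => [s' sz_s']; apply/negP/av; rewrite sz_s'.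
Qed.

End Invariance.

Definition supported S phi := [forall x, (0 < phi x) ==> S (val x.1) (val x.2)].

Lemma supportedP S phi :
  reflect (forall x y, 0 < entry phi x y -> S x y) (supported S phi).
Proof.
apply: (iffP forallP) => [sup x y gt0|sup [x y]].
  have /andP[lex ley] := entry_gt0 gt0.
  have := sup (inord x, inord y); rewrite /= !inordK // => /implyP; apply.
  by move: gt0; rewrite /entry lex ley.
apply/implyP => gt0; apply: sup; rewrite /entry !leq_ord !inord_val; exact: gt0.
Qed.

Lemma supported_rentry b S phi x i :
  supported S phi -> 0 < rentry b phi x i -> S x (read M b i).
Proof.
by move=> /supportedP sup; rewrite /rentry; case: ifP => // _; apply: sup.
Qed.

Lemma supported_fcol b S c phi : c < M -> (forall y, S c.+1 y = S c y) ->
  0 < phicol b c phi -> supported S (fcol b c phi) = supported S phi.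
Proof.
move=> lt_c eqS gt0; have [q st] := fcolP lt_c gt0; have le_q := step_le st.
have sup_q psi psi' : supported S psi ->
    (forall x i, x <= M -> i <= M -> 0 < rentry b psi' x i ->
       0 < rentry b psi x i \/ exists2 x', S x' =1 S x & 0 < rentry b psi x' i) ->
    supported S psi'.
  move=> sup le_psi; apply/supportedP => x y gt0'; have /andP[lex ley] := entry_gt0 gt0'.
  rewrite (entry_read b) // in gt0'; rewrite -(readK b ley).
  case: (le_psi x (read M b y) lex (read_le b ley) gt0') => [|[x' <-]];
  exact: supported_rentry.
apply/idP/idP => sup; apply: (sup_q _ _ sup) => x i lex lei.
  rewrite (step_rentry st) //; case: (eqVneq i q) => [->|]; last by left.
  case: (eqVneq x c) => [->|nec]; last by case: eqP; left.
  move=> gt0'; right; exists c.+1 => //.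
  by rewrite (step_rentry st) // !eqxx ifN //; lia.
rewrite (step_rentry st) //; case: (eqVneq i q) => [->|]; last by left.
case: (eqVneq x c) => [->|nec]; first by left; have := step_gt0 st.
case: (eqVneq x c.+1) => [->|nec1]; last by left.
by right; exists c => //; exact: step_gt0 st.
Qed.

End Chains.

(** Elements of the same rank in the two fibres over a key are matched, both fibres being listed by
    [E]. *)
Lemma fiber_bijection (X K : eqType) (k1 k2 : X -> K) (E : K -> seq X) :
    (forall c, uniq (E c)) ->
    (forall x, x \in E (k1 x)) -> (forall x, x \in E (k2 x)) ->
    (forall c, count (fun x => k1 x == c) (E c) = count (fun x => k2 x == c) (E c)) ->
  exists g g' : X -> X, [/\ cancel g g', cancel g' g & forall x, k2 (g x) = k1 x].
Proof.
move=> uE E1 E2 eq_count.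
pose e (k : X -> K) c := [seq x <- E c | k x == c].
have ue k c : uniq (e k c) by apply: filter_uniq.
pose match_ (k k' : X -> K) x := nth x (e k' (k x)) (index x (e k (k x))).
have matchP (k k' : X -> K) : (forall x, x \in E (k x)) ->
    (forall c, size (e k c) = size (e k' c)) ->
    forall x, k' (match_ k k' x) = k x /\ match_ k' k (match_ k k' x) = x.
  move=> Ek sz x.
  have x_in : x \in e k (k x) by rewrite mem_filter eqxx Ek.
  have lt_i : index x (e k (k x)) < size (e k' (k x)) by rewrite -sz index_mem.
  have := mem_nth x lt_i; rewrite mem_filter -/(match_ k k' x).
  move=> /andP[/eqP kE _]; split=> //.
  by rewrite {1}/match_ kE index_uniq // (set_nth_default x) ?nth_index ?index_mem.
have sz c : size (e k1 c) = size (e k2 c) by rewrite !size_filter.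
exists (match_ k1 k2), (match_ k2 k1); split=> x.
- by case: (matchP k1 k2 E1 sz x).
- by case: (matchP k2 k1 E2 _ x).
- by case: (matchP k1 k2 E1 sz x).
Qed.

Lemma count_split (X : Type) (P Q : pred X) (s : seq X) :
  count P s = count (fun x => P x && Q x) s + count (fun x => P x && ~~ Q x) s.
Proof. by elim: s => //= x s ->; case: (P x); case: (Q x) => /=; lia. Qed.

(** * Equinumerous avoidance classes *)

Section Peel.

Variable M : nat.
Implicit Types (phi psi : board M) (b : bool) (S : nat -> nat -> bool).

Definition margins := ({ffun 'I_M.+1 -> nat} * {ffun 'I_M.+1 -> nat})%type.

Implicit Type K : margins.

Definition sums phi : margins :=
  ([ffun y : 'I_M.+1 => rowsum phi y], [ffun x : 'I_M.+1 => colsum phi x]).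

Definition boards_le B : seq (board M) :=
  [seq ([ffun p => val (g p)] : board M) |
    g : {ffun 'I_M.+1 * 'I_M.+1 -> 'I_B.+1} <- enum predT].

Lemma boards_le_uniq B : uniq (boards_le B).
Proof.
rewrite map_inj_uniq ?enum_uniq // => g g' /ffunP eq_g.
by apply/ffunP => p; apply/val_inj; have := eq_g p; rewrite !ffunE.
Qed.

Lemma mem_boards_le B phi : (forall p, phi p <= B) -> phi \in boards_le B.
Proof.
move=> leB; apply/mapP; exists [ffun p => inord (phi p)]; first by rewrite mem_enum.
by apply/ffunP => p; rewrite !ffunE /= inordK ?ltnS.
Qed.

(* A list containing every board with row sums K.1. *)
Definition boards_of K :=
  boards_le (\sum_y K.1 y).

Lemma mem_boards_of K phi : (forall y : 'I_M.+1, rowsum phi y = K.1 y) ->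
  phi \in boards_of K.
Proof.
move=> rowE; apply: mem_boards_le => -[x y].
rewrite (bigD1 y) //= -rowE /rowsum (bigD1 x) //= -addnA.
by rewrite {1}/entry !leq_ord !inord_val leq_addr.
Qed.

Definition equinum S k := forall K,
  count (fun phi => [&& supported S phi, avoids true S k phi & sums phi == K])
    (boards_of K)
  = count (fun phi => [&& supported S phi, avoids false S k phi & sums phi == K])
    (boards_of K).

Lemma avoids_eq b S k phi psi :
    (forall x i, S x (read M b i) -> rentry b phi x i = rentry b psi x i) ->
  avoids b S k phi = avoids b S k psi.
Proof.
move=> eq_e; suff ch_eq s : chain b S phi s = chain b S psi s.
  by congr (~~ _); apply: eq_existsb => t; rewrite ch_eq.
by apply/chainP/chainP => -[us s_lt sS s_gt0]; split=> // p ps;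
  move: (s_gt0 p ps); rewrite eq_e // sS.
Qed.

Lemma avoids_sub b S S' k phi : (forall x y, S' x y -> S x y) ->
  avoids b S k phi -> avoids b S' k phi.
Proof.
move=> sub /avoidsP av; apply/avoidsP => s /av; apply: contraNN.
by case/chainP=> us s_lt sS s_gt0; apply/chainP; split=> // p q ps qs; apply/sub/sS.
Qed.

Lemma avoidsS b S k phi : avoids b S k phi -> avoids b S k.+1 phi.
Proof.
move=> /avoidsP av; apply/avoidsP => -[//|p s] [/av]; apply: contraNN.
case/chainP=> /= /andP[_ us] s_lt sS s_gt0; apply/chainP; split=> //.
- by move=> q r qs rs; apply: s_lt; rewrite inE ?qs ?rs orbT.
- by move=> q r qs rs; apply: sS; rewrite inE ?qs ?rs orbT.
- by move=> q qs; apply: s_gt0; rewrite inE qs orbT.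
Qed.

Lemma avoids_large b S k phi : M.+1 < k -> avoids b S k phi.
Proof.
move=> lt_k; apply/avoidsP => s sz_s; apply/negP => /chainP[us s_lt _ s_gt0].
suff : size s <= M.+1 by rewrite sz_s leqNgt lt_k.
rewrite -(size_map fst) -(size_iota 0 M.+1); apply: uniq_leq_size => [|x].
  rewrite map_inj_in_uniq // => p q ps qs eq_p; apply/eqP.
  by have := s_lt p q ps qs; rewrite /lt2 eq_p ltnn !orbF.
case/mapP=> p ps ->; rewrite mem_iota ltnS.
by have /andP[] := rentry_gt0 (s_gt0 p ps).
Qed.

(** Avoidance is monotone in the length and holds beyond [M.+1], since the columns of a chain are
    distinct; so this counts up to the length of the longest chain. *)
Definition max_chain b S phi := \sum_(k < M.+1) ~~ avoids b S k.+1 phi.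

Lemma max_chain_le b S phi k : (max_chain b S phi <= k) = avoids b S k.+1 phi.
Proof.
have ex_k : exists k, avoids b S k.+1 phi by exists M.+1; apply: avoids_large.
case: (ex_minnP ex_k) => m av_m min_m.
have avE i : avoids b S i.+1 phi = (m <= i).
  apply/idP/idP => [/min_m //|]; elim: i => [|i IHi].
    by rewrite leqn0 => /eqP <-.
  by rewrite leq_eqVlt => /predU1P[<- //|/IHi]; apply: avoidsS.
have le_m : m <= M.+1 by apply: min_m; apply: avoids_large.
rewrite avE; congr (_ <= _); rewrite /max_chain.
rewrite (eq_bigr (fun i : 'I_M.+1 => nat_of_bool (i < m))); last first.
  by move=> i _; rewrite avE -ltnNge.
rewrite -(big_mkord xpredT (fun i => nat_of_bool (i < m))) (big_cat_nat (leq0n m) le_m) /=.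
rewrite (eq_big_nat _ _ (F2 := fun=> 1)) => [|i /andP[_ ->] //].
rewrite sum_nat_const_nat subn0 muln1 big_nat big1 ?addn0 // => i.
by case/andP=> le_mi _; rewrite ltnNge le_mi.
Qed.

Lemma equinum_bij S : (forall k, equinum S k.+1) ->
  exists g g' : board M -> board M, [/\ cancel g g', cancel g' g &
    forall phi, [/\ sums (g phi) = sums phi, supported S (g phi) = supported S phi
      & supported S phi ->
        forall k, avoids false S k.+1 (g phi) = avoids true S k.+1 phi]].
Proof.
(* The factor [supported S phi] hides the chains of boards outside the shape, so that the bijection
   extends to all boards and respects supports. *)
move=> eqn; pose key b phi : margins * bool * nat :=
  (sums phi, supported S phi, supported S phi * max_chain b S phi).
have [||||g [g' [gK g'K keyE]]] :=
    @fiber_bijection _ _ (key true) (key false) (fun c => boards_of c.1.1).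
- by move=> c; apply: boards_le_uniq.
- by move=> phi; apply: mem_boards_of => y; rewrite ffunE.
- by move=> phi; apply: mem_boards_of => y; rewrite ffunE.
- case=> [[K s] m].
  have keyE b phi : (key b phi == (K, s, m)) = [&& sums phi == K, supported S phi == s
      & supported S phi * max_chain b S phi == m].
    by rewrite /key 2!xpair_eqE andbA.
  pose cnt b k := count (fun phi =>
    [&& supported S phi, avoids b S k.+1 phi & sums phi == K]) (boards_of K).
  (* Longest length exactly [k.+1] means avoiding length [k.+2] but not [k.+1], whence the
     difference. *)
  have cntE b : count (fun phi => key b phi == (K, s, m)) (boards_of K) =
      if s then (if m is k.+1 then cnt b k.+1 - cnt b k else cnt b 0)
      else if m is k.+1 then 0
      else count (fun phi => ~~ supported S phi && (sums phi == K)) (boards_of K).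
    case: s keyE; case: m => [|k] keyE; rewrite /cnt.
    + apply: eq_count => phi; rewrite keyE -max_chain_le leqn0.
      by case: (supported S phi); rewrite ?andbF ?mul1n //= andbC.
    + rewrite [X in _ = X - _](count_split _ (avoids b S k.+1)) /=.
      have -> : count (fun phi => [&& supported S phi, avoids b S k.+2 phi
          & sums phi == K] && avoids b S k.+1 phi) (boards_of K) = cnt b k.
        apply: eq_count => phi; case av: (avoids b S k.+1 phi); rewrite ?andbF //=.
        by rewrite (avoidsS av) andbT.
      rewrite /cnt addKn; apply: eq_count => phi; rewrite keyE -!max_chain_le.
      case: (supported S phi); rewrite ?andbF ?mul1n //= eqn_leq -ltnNge.
      by case: (sums phi == K); rewrite ?andbF ?andbT.
    + apply: eq_count => phi; rewrite keyE.
      by case: (supported S phi); rewrite ?andbF ?mul0n //= andbT.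
    + apply/eqP; rewrite -leqn0 leqNgt -has_count; apply/hasPn => phi _.
      by rewrite keyE; case: (supported S phi); rewrite ?andbF ?mul0n ?andbF.
  by rewrite !cntE /cnt; case: (m) => [|k]; rewrite !eqn.
exists g, g'; split=> // phi; have := keyE phi; rewrite /key => /eqP.
rewrite 2!xpair_eqE => /andP[/andP[/eqP -> /eqP supE] /eqP mE].
split=> // sup k; rewrite -!max_chain_le.
by move: mE; rewrite supE sup !mul1n => ->.
Qed.

(** * Chains through the row to be removed *)

Section Row.

Variables (S : nat -> nat -> bool) (k x0 n y0 : nat).
Hypothesis le_n : x0 + n <= M.
Hypothesis S_row : forall x, S x y0 = (x0 <= x <= x0 + n).
Hypothesis S_col : forall x y, x0 <= x <= x0 + n -> S x y = S x0 y.

Definition drop_row x y := S x y && (y != y0).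

(** Induction on the column: without violations, a nonzero entry is preceded by one in the previous
    column, in an earlier row. The columns used agree in [S], so the whole grid lies in the
    shape. *)
Lemma yam_chain b phi (j : 'I_n.+1) i :
    supported S phi -> yam (col_crystal b le_n) phi -> 0 < rentry b phi (x0 + j) i ->
  exists2 s, size s = j.+1 &
    chain b S phi s /\ forall p, p \in s -> (x0 <= p.1 <= x0 + j) && (p.2 <= i).
Proof.
move=> sup yam_phi; case: j => j /=; elim: j i => [|j IHj] i lt_j gt0.
  exists [:: (x0 + 0, i)] => //; split; last first.
    by move=> p; rewrite inE => /eqP -> /=; rewrite !addn0 !leqnn.
  rewrite /chain /= eqxx gt0 !andbT /=; exact: supported_rentry gt0.
have lt_jn : j < n by [].
have [i' lt_i' gt0'] : exists2 i', i' < i & 0 < rentry b phi (x0 + j) i'.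
  have /andP[_ lei] := rentry_gt0 gt0.
  have /= eps0 := viol_None (Ordinal lt_jn) (eqP yam_phi).
  case: (pickP (fun i' : 'I_i => 0 < rentry b phi (x0 + j) i')) => [i' gt0'|no_i'].
    by exists i'.
  have: 0 < epscol b (x0 + j) phi.
    apply/epscol_gt0; exists i => //; rewrite /overfull big1; last first.
      by move=> i' _; have := no_i' i'; case: (rentry _ _ _ _).
    by rewrite big_ord_recr /= -addnS; apply: leq_trans gt0 (leq_addl _ _).
  by rewrite eps0.
have [s sz_s [ch s_le]] := IHj i' (ltnW lt_j) gt0'.
exists ((x0 + j.+1, i) :: s); first by rewrite /= sz_s.
have [us s_lt sS s_gt0] := chainP _ _ _ _ ch.
have s_lt2 p : p \in s -> lt2 p (x0 + j.+1, i).
  by move/s_le; rewrite /lt2 /=; lia.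
have S_any x p : x0 <= x <= x0 + n -> p \in (x0 + j.+1, i) :: s -> S x (read M b p.2).
  move=> lex; have Sp : p \in (x0 + j.+1, i) :: s ->
      (x0 <= p.1 <= x0 + n) /\ (S p.1 (read M b p.2)).
    rewrite inE => /predU1P[->|ps] /=.
      by split; [lia|exact: supported_rentry gt0].
    by split; [have := s_le p ps; lia|exact: sS].
  by case/Sp=> lep; rewrite !S_col.
split; last first.
  move=> p; rewrite inE => /predU1P[-> /=|/s_le]; first by rewrite leq_addr !leqnn.
  lia.
apply/chainP; split.
- by rewrite /= us andbT; apply/negP => /s_lt2; rewrite /lt2 ltnn.
- move=> p q; rewrite !inE => /predU1P[->|ps] /predU1P[->|qs].
  + by rewrite eqxx.
  + by rewrite (s_lt2 q) // !orbT.
  + by rewrite (s_lt2 p) // orbT.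
  + exact: s_lt.
- move=> p q ps qs; apply: S_any => //; move: ps; rewrite inE => /predU1P[-> /=|/s_le]; lia.
- by move=> p; rewrite inE => /predU1P[->|/s_gt0].
Qed.

(** Vacuous for [k > n]. For a partition it says that at most [k] columns are nonzero. *)
Definition content_ok (nu : {ffun 'I_n.+1 -> nat}) :=
  [forall i : 'I_n.+1, (i == k :> nat) ==> (nu i == 0)].

Lemma avoids_yam b phi : supported S phi -> yam (col_crystal b le_n) phi ->
  avoids b drop_row k.+1 phi ->
  avoids b S k.+1 phi = content_ok (col_content x0 n phi).
Proof.
move=> sup yam_phi av'; apply/idP/idP => [av|/forallP ok].
  apply/forallP => j; apply/implyP => /eqP jk; rewrite -leqn0 leqNgt; apply/negP.
  rewrite ffunE (colsumE b) => gt0.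
  have [i gt0_i] : exists i : 'I_M.+1, 0 < rentry b phi (x0 + j) i.
    apply/existsP; apply: contraLR gt0; rewrite negb_exists => /forallP no_i.
    by rewrite -leqNgt leqn0 big1 // => i _; have := no_i i; case: (rentry _ _ _ _).
  have [s sz_s [ch _]] := yam_chain sup yam_phi gt0_i.
  by have /avoidsP/(_ s) := av; rewrite sz_s jk ch => /(_ erefl).
apply/avoidsP => s sz_s; apply/negP => ch.
have [us s_lt sS s_gt0] := chainP _ _ _ _ ch.
(* A chain of length [k.+1] does not fit in the smaller shape, so it uses row [y0], and then all its
   columns meet that row. *)
have /allPn[p ps /allPn[q qs]] : ~~ all (fun p => all (fun q => drop_row p.1 (read M b q.2)) s) s.
  apply: contraL av' => /allP s'S; apply/negP => /avoidsP/(_ s sz_s)/chainP; apply.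
  by split=> // p q ps qs; have /allP/(_ q qs) := s'S p ps.
rewrite /drop_row sS // negbK => /eqP q_y0.
have s_col (r : nat * nat) : r \in s -> x0 <= r.1 <= x0 + n.
  by move=> rs; rewrite -S_row -q_y0 sS.
have part := yam_partition yam_phi.
have s_k (r : nat * nat) : r \in s -> r.1 < x0 + k.
  move=> rs; have lr := s_col r rs; rewrite ltnNge; apply/negP => lek.
  have lt_r : r.1 - x0 < n.+1 by lia.
  have lt_k : k < n.+1 by lia.
  have := ok (Ordinal lt_k); rewrite eqxx /= => /eqP ct0.
  have le_kr : Ordinal lt_k <= Ordinal lt_r by rewrite /=; lia.
  have := partition_likeP part le_kr; rewrite /= ct0 leqn0.
  rewrite ffunE /= subnKC; last by lia.
  rewrite (colsumE b); have /rentry_gt0/andP[_ ler] := s_gt0 r rs.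
  rewrite sum_nat_eq0 => /forallP/(_ (inord r.2)); rewrite /= inordK //.
  by have := s_gt0 r rs; case: (rentry _ _ _ _).
suff : size s <= k by rewrite sz_s ltnn.
rewrite -(size_map fst) -(size_iota x0 k); apply: uniq_leq_size => [|x].
  rewrite map_inj_in_uniq // => r r' rs rs' eq_r; apply/eqP.
  by have := s_lt r r' rs rs'; rewrite /lt2 eq_r ltnn !orbF.
by case/mapP=> r rs ->; rewrite mem_iota s_k // andbT; case/andP: (s_col r rs).
Qed.

End Row.
End Peel.

(** * Putting the removed row back *)

Section Induction.

Variable M : nat.
Implicit Types (phi psi : board M) (b : bool) (S : nat -> nat -> bool).
Implicit Type K : margins M.

Section PeelRow.

Variables (S : nat -> nat -> bool) (k x0 n y0 : nat).
Hypothesis le_n : x0 + n <= M.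
Hypothesis le_y0 : y0 <= M.
Hypothesis S_row : forall x, S x y0 = (x0 <= x <= x0 + n).
Hypothesis S_col : forall x y, x0 <= x <= x0 + n -> S x y = S x0 y.
Hypothesis S_bot : forall x y, S x y -> y0 <= y.
Hypothesis col_conv : forall x y y' z, S x y -> S x y' -> y <= z <= y' -> S x z.

Let S' := drop_row S y0.

Definition strip_row phi : board M :=
  mkboard M (fun x y => if y == y0 then 0 else entry phi x y).

Definition glue_row phi psi : board M :=
  mkboard M (fun x y => if y == y0 then entry phi x y else entry psi x y).

Lemma glue_strip phi : glue_row phi (strip_row phi) = phi.
Proof.
apply: entry_inj => x y lex ley; rewrite !entry_mkboard //.
by case: (y == y0).
Qed.

Lemma glue_glue phi psi chi : glue_row (glue_row phi psi) chi = glue_row phi chi.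
Proof.
by apply: entry_inj => x y lex ley; rewrite !entry_mkboard //; case: (y == y0).
Qed.

Lemma supported_drop_row0 psi x : supported S' psi -> entry psi x y0 = 0.
Proof.
move=> /supportedP/(_ x y0); case: (entry psi x y0) => // m /(_ isT).
by rewrite /S' /drop_row eqxx andbF.
Qed.

Lemma strip_glue phi psi : supported S' psi -> strip_row (glue_row phi psi) = psi.
Proof.
move=> sup; apply: entry_inj => x y lex ley; rewrite !entry_mkboard //.
by case: eqP => // ->; rewrite supported_drop_row0.
Qed.

Lemma supported_strip phi : supported S phi -> supported S' (strip_row phi).
Proof.
move=> /supportedP sup; apply/supportedP => x y gt0.
have /andP[lex ley] := entry_gt0 gt0; move: gt0; rewrite entry_mkboard //.
by rewrite /S' /drop_row; case: eqP => // _ /sup ->.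
Qed.

Lemma supported_glue phi psi :
  supported S phi -> supported S' psi -> supported S (glue_row phi psi).
Proof.
move=> /supportedP sup /supportedP sup'; apply/supportedP => x y gt0.
have /andP[lex ley] := entry_gt0 gt0; move: gt0; rewrite entry_mkboard //.
by case: eqP => _; [apply: sup|case/sup'/andP].
Qed.

Lemma sums_glue phi psi psi' : supported S' psi -> supported S' psi' ->
  sums psi = sums psi' -> sums (glue_row phi psi) = sums (glue_row phi psi').
Proof.
move=> sup sup' [/ffunP eq_r /ffunP eq_c].
have rowE chi (y : 'I_M.+1) : rowsum (glue_row phi chi) y =
    if y == y0 :> nat then rowsum phi y else rowsum chi y.
  rewrite /rowsum; case: eqP => yE; apply: eq_bigr => x _;
  by rewrite entry_mkboard ?leq_ord //; case: eqP.
have colE chi (x : 'I_M.+1) : supported S' chi ->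
    colsum (glue_row phi chi) x = entry phi x y0 + colsum chi x.
  move=> sup_chi; have lt_y0 : y0 < M.+1 by [].
  rewrite /colsum (bigD1 (Ordinal lt_y0)) //= [in RHS](bigD1 (Ordinal lt_y0)) //=.
  rewrite entry_mkboard ?leq_ord // eqxx (supported_drop_row0 _ sup_chi) add0n; congr (_ + _).
  apply: eq_bigr => y; rewrite -val_eqE /= => /negPf ne_y.
  by rewrite entry_mkboard ?leq_ord // ne_y.
congr (_, _); apply/ffunP => z; rewrite !ffunE.
  by have := eq_r z; rewrite !ffunE !rowE => ->.
by have := eq_c z; rewrite !ffunE !colE // => ->.
Qed.

Lemma avoids_glue b phi psi m : avoids b S' m (glue_row phi psi) = avoids b S' m psi.
Proof.
apply: avoids_eq => x i /andP[_ /negPf ne_y].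
rewrite /rentry; case: ifP => // lei; rewrite /entry; case: ifP => // /andP[lex ley].
by rewrite ffunE !inordK // ne_y /entry lex ley.
Qed.

Lemma avoids_strip b phi m : avoids b S' m (strip_row phi) = avoids b S' m phi.
Proof. by rewrite -[in RHS](glue_strip phi) avoids_glue. Qed.

(** The bijection for the smaller shape acts on the board without row [y0], which is then put back
    unchanged. As it preserves margins there, the margins of the whole board are preserved too. *)
Lemma equinum_glue K : (forall m, equinum M S' m.+1) ->
  count (fun phi => [&& supported S phi, avoids true S' k.+1 phi & sums phi == K])
    (boards_of K)
  = count (fun phi => [&& supported S phi, avoids false S' k.+1 phi & sums phi == K])
    (boards_of K).
Proof.
move=> /equinum_bij[g [g' [gK g'K gP]]].
have g'P phi : [/\ sums (g' phi) = sums phi, supported S' (g' phi) = supported S' phi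
      & supported S' phi ->
        forall m, avoids true S' m.+1 (g' phi) = avoids false S' m.+1 phi].
  have [] := gP (g' phi); rewrite g'K => -> -> av; split=> // sup m.
  by rewrite av.
pose h (f : board M -> board M) phi := glue_row phi (f (strip_row phi)).
have inE phi (B : bool) : [&& supported S phi, B & sums phi == K] -> phi \in boards_of K.
  case/and3P=> _ _ /eqP <-; apply: mem_boards_of => y; by rewrite ffunE.
apply: (@count_bij _ _ _ _ _ (h g) (h g')) => [||phi|phi|phi|phi]; rewrite ?boards_le_uniq //.
- exact: inE.
- exact: inE.
- case/and3P=> sup av /eqP sumK; have sup' := supported_strip sup.
  have [sumE supE avE] := gP (strip_row phi).
  have supg : supported S' (g (strip_row phi)) by rewrite supE.
  rewrite /h supported_glue // avoids_glue avE // avoids_strip av.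
  rewrite (sums_glue phi supg sup' sumE) glue_strip sumK eqxx; split=> //.
  by rewrite strip_glue // gK glue_glue glue_strip.
- case/and3P=> sup av /eqP sumK; have sup' := supported_strip sup.
  have [sumE supE avE] := g'P (strip_row phi).
  have supg : supported S' (g' (strip_row phi)) by rewrite supE.
  rewrite /h supported_glue // avoids_glue avE // avoids_strip av.
  rewrite (sums_glue phi supg sup' sumE) glue_strip sumK eqxx; split=> //.
  by rewrite strip_glue // g'K glue_glue glue_strip.
Qed.

(** These margins are constant along the crystal; the remaining column sums are its content. *)
Definition other_margins K phi :=
  [forall y : 'I_M.+1, rowsum phi y == K.1 y] &&
  [forall x : 'I_M.+1, ~~ (x0 <= x <= x0 + n) ==> (colsum phi x == K.2 x)].

Definition set_content K (nu : {ffun 'I_n.+1 -> nat}) : margins M :=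
  (K.1, [ffun x : 'I_M.+1 => if x0 <= x <= x0 + n then nu (inord (x - x0)) else K.2 x]).

Lemma sums_set_content K nu phi :
  (sums phi == set_content K nu) =
  other_margins K phi && (col_content x0 n phi == nu).
Proof.
rewrite xpair_eqE /other_margins -andbA; congr andb.
  apply/eqP/forallP => [/ffunP eqf y|eqf]; first by have := eqf y; rewrite ffunE => ->.
  by apply/ffunP => y; rewrite ffunE; apply/eqP.
apply/eqP/andP => [/ffunP eqf|[/forallP eqo /eqP eqc]].
  split; first apply/forallP => x.
    by apply/implyP => /negPf nx; have := eqf x; rewrite !ffunE nx => ->.
  apply/eqP/ffunP => i; have lt_i : x0 + i < M.+1 by have := ltn_ord i; lia.
  have := eqf (Ordinal lt_i); rewrite !ffunE /= leq_addr leq_add2l leq_ord /=.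
  by rewrite addKn inord_val.
apply/ffunP => x; rewrite !ffunE; case: ifP => [/andP[le1 le2]|/negbT nx].
  have lt_x : x - x0 < n.+1 by lia.
  by rewrite -eqc ffunE inordK // subnKC.
by have := eqo x; rewrite nx => /eqP.
Qed.

Lemma set_contentK K : set_content K [ffun i : 'I_n.+1 => K.2 (inord (x0 + i))] = K.
Proof.
case: K => r c; congr (_, _); apply/ffunP => x; rewrite ffunE /=.
case: ifP => // /andP[le1 le2]; rewrite ffunE inordK; last by lia.
by rewrite subnKC // inord_val.
Qed.

Lemma equinum_peel : (forall m, equinum M S' m.+1) -> equinum M S k.+1.
Proof.
move=> eqS' K; rewrite -(set_contentK K); set nu := [ffun i => _].
pose D b phi := [&& supported S phi, avoids b S' k.+1 phi & other_margins K phi].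
pose P b phi := avoids b S k.+1 phi.
(* Columns stay convex because the removed row is the lowest one. *)
have colS' x y y' z : S' x y -> S' x y' -> y <= z <= y' -> S' x z.
  case/andP=> Sy ne_y /andP[Sy' _] lez; rewrite /S' /drop_row (col_conv Sy Sy') //.
  by have := S_bot Sy; lia.
have lt_col (j : 'I_n) : x0 + j < M by have := ltn_ord j; lia.
have eqcol (j : 'I_n) y : S (x0 + j).+1 y = S (x0 + j) y.
  by have lt_j := ltn_ord j; rewrite !S_col //; lia.
have eqcol' (j : 'I_n) y : S' (x0 + j).+1 y = S' (x0 + j) y.
  by rewrite /S' /drop_row eqcol.
have clP b : crystal_closed (col_crystal b le_n) (P b).
  by move=> j phi gt0; apply: avoids_fcol (eqcol j) col_conv _ _ gt0.
have clD b : crystal_closed (col_crystal b le_n) (D b).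
  move=> j phi gt0; rewrite /D (supported_fcol (lt_col j) (eqcol j) gt0).
  rewrite (avoids_fcol (lt_col j) (eqcol' j) colS' _ gt0); congr [&& _, _ & _].
  rewrite /other_margins; congr andb.
    by apply: eq_forallb => y; rewrite rowsum_fcol ?leq_ord.
  apply: eq_forallb => x; case: (boolP (x0 <= x <= x0 + n)) => //= nx.
  have [_ _ colE] := colsum_fcol (lt_col j) gt0.
  by have lt_j := ltn_ord j; rewrite colE ?leq_ord //; lia.
have sD b phi : D b phi -> phi \in boards_of (set_content K nu).
  case/and3P=> _ _ /andP[/forallP rowE _]; apply: mem_boards_of => y.
  exact/eqP/rowE.
have := @crystal_transfer n _ (col_crystal true le_n) (col_crystal false le_n)
  (boards_of (set_content K nu)) (D true) (D false) (P true) (P false)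
  (@content_ok k n).
have cntE b : ct_count (col_crystal b le_n) (boards_of (set_content K nu))
    (predI (D b) (P b)) nu = count (fun phi =>
    [&& supported S phi, avoids b S k.+1 phi & sums phi == set_content K nu])
    (boards_of (set_content K nu)).
  apply: eq_count => phi; rewrite sums_set_content /= /D /P.
  have sub : avoids b S k.+1 phi -> avoids b S' k.+1 phi.
    by apply: avoids_sub => x y /andP[].
  case: (avoids b S k.+1 phi) sub => [-> //|_]; rewrite ?andbF //.
  by case: (supported S phi) => //=; rewrite ?andbT.
move=> tr; rewrite -!cntE; apply: tr => //.
- exact: boards_le_uniq.
- exact: sD.
- exact: sD.
- move=> phi /and3P[sup av _] yam_phi.
  exact: (avoids_yam S_row S_col).
- move=> phi /and3P[sup av _] yam_phi.
  exact: (avoids_yam S_row S_col).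
move=> nu'; rewrite /ct_count.
(* [boards_of] reads only the row sums, so the list is the same for [nu] and [nu']. *)
have cntD b : count (fun phi => D b phi && (ct (col_crystal b le_n) phi == nu'))
    (boards_of (set_content K nu)) = count (fun phi =>
    [&& supported S phi, avoids b S' k.+1 phi & sums phi == set_content K nu'])
    (boards_of (set_content K nu')).
  by apply: eq_count => phi; rewrite sums_set_content /D /= -!andbA.
by rewrite !cntD equinum_glue.
Qed.

End PeelRow.
End Induction.

(** * Transposition and induction over D-free skew shapes *)

Section Transpose.

Variable M : nat.
Implicit Types (phi psi : board M) (b : bool) (S : nat -> nat -> bool).

Definition transpose S x y := S y x : bool.

Definition tr_board phi : board M := mkboard M (fun x y => entry phi y x).

Lemma entry_tr phi x y : entry (tr_board phi) x y = entry phi y x.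
Proof.
case: (boolP ((x <= M) && (y <= M))) => [/andP[lex ley]|ne].
  by rewrite entry_mkboard.
by rewrite /entry (negPf ne) andbC (negPf ne).
Qed.

Lemma tr_boardK : involutive tr_board.
Proof. by move=> phi; apply: entry_inj => x y _ _; rewrite !entry_tr. Qed.

Lemma supported_tr S phi : supported (transpose S) (tr_board phi) = supported S phi.
Proof.
apply/supportedP/supportedP => sup x y; last by rewrite entry_tr; apply: sup.
by rewrite -entry_tr; apply: sup.
Qed.

Lemma sums_tr phi : sums (tr_board phi) = ((sums phi).2, (sums phi).1).
Proof.
by congr (_, _); apply/ffunP => z; rewrite !ffunE;
  apply: eq_bigr => i _; rewrite entry_tr.
Qed.

(** Transposition keeps the direction of a chain, hence the same [b]. For [b = true] it reverses the
    order of the cells, which does not matter for unordered chains. *)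
Lemma chain_tr b S phi s : chain b S phi s ->
  chain b (transpose S) (tr_board phi) [seq (read M b p.2, read M b p.1) | p <- s].
Proof.
case/chainP=> us s_lt sS s_gt0.
have le_s p : p \in s -> p.1 <= M /\ p.2 <= M by move/s_gt0/rentry_gt0/andP.
apply/chainP; split.
- rewrite map_inj_in_uniq // => -[x i] [x' i'] /le_s[/= lex lei] /le_s[/= lex' lei'].
  case=> /(congr1 (read M b)) + /(congr1 (read M b)).
  by rewrite !readK // => -> ->.
- move=> _ _ /mapP[[x i] ps ->] /mapP[[x' i'] qs ->] /=.
  have := s_lt _ _ ps qs; have [/= le1 le2] := le_s _ ps.
  have [/= le3 le4] := le_s _ qs.
  case/or3P=> [/eqP[-> ->]|/andP[/= lt1 lt2]|/andP[/= lt1 lt2]]; apply/or3P.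
  + exact: Or31.
  + case: b {s_lt sS s_gt0 le_s ps qs} => /=; [apply: Or33|apply: Or32];
    by apply/andP; split=> /=; lia.
  + case: b {s_lt sS s_gt0 le_s ps qs} => /=; [apply: Or32|apply: Or33];
    by apply/andP; split=> /=; lia.
- move=> _ _ /mapP[p ps ->] /mapP[q qs ->] /=.
  by rewrite /transpose readK ?sS //; case: (le_s q qs).
- move=> _ /mapP[p ps ->] /=; have [le1 le2] := le_s p ps.
  rewrite /rentry read_le // readK // entry_tr.
  by have := s_gt0 p ps; rewrite /rentry le2.
Qed.

Lemma avoids_tr b S k phi :
  avoids b (transpose S) k (tr_board phi) = avoids b S k phi.
Proof.
suff av_tr T psi : avoids b (transpose T) k (tr_board psi) -> avoids b T k psi.
  apply/idP/idP; first exact: av_tr.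
  by move=> av; apply: av_tr; rewrite tr_boardK.
move=> /avoidsP av; apply/avoidsP => s sz_s; apply/negP => /chain_tr.
by apply/negP/av; rewrite size_map.
Qed.

Lemma equinum_tr S k : equinum M (transpose S) k -> equinum M S k.
Proof.
move=> eqT K; have cntE b :
    count (fun phi => [&& supported S phi, avoids b S k phi & sums phi == K]) (boards_of K)
    = count (fun phi => [&& supported (transpose S) phi,
        avoids b (transpose S) k phi & sums phi == (K.2, K.1)]) (boards_of (K.2, K.1)).
  have inE K' phi (B B' : bool) : [&& B, B' & sums phi == K'] -> phi \in boards_of K'.
    by case/and3P=> _ _ /eqP <-; apply: mem_boards_of => y; rewrite ffunE.
  apply: (@count_bij _ _ _ _ _ tr_board tr_board) => [||phi|phi|phi|phi];
    rewrite ?boards_le_uniq //.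
  - exact: inE.
  - exact: inE.
  - case/and3P=> sup av /eqP sumE.
    by rewrite supported_tr avoids_tr sup av sums_tr sumE eqxx tr_boardK.
  - case/and3P=> sup av /eqP sumE; rewrite -supported_tr -avoids_tr sums_tr sumE.
    rewrite !tr_boardK; split=> //; apply/and3P; split=> //.
    by case: (K).
by rewrite !cntE eqT.
Qed.

(** [skew_conv] expresses skewness as a convexity: the rectangle between a cell and another one
    weakly to its south-east lies in the shape. *)
Record D_free_skew S : Prop := DFreeSkew {
  skew_le : forall x y, S x y -> (x <= M) && (y <= M);
  skew_conv : forall x y x' y' z t, S x y -> S x' y' ->
    x <= z <= x' -> y' <= t <= y -> S z t;
  skew_D : forall c1 c2 c3 r1 r2 r3, c1 < c2 < c3 -> r1 < r2 < r3 ->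
    ~~ [&& S c1 r1, S c1 r2, ~~ S c1 r3, S c2 r1, S c2 r2, S c2 r3,
           ~~ S c3 r1, S c3 r2 & S c3 r3]
}.

Lemma D_free_skew_tr S : D_free_skew S -> D_free_skew (transpose S).
Proof.
case=> S_le S_conv S_D; split=> [x y /S_le|x y x' y' z t Sxy Sxy' lez let_|].
- by rewrite andbC.
- exact: S_conv Sxy' Sxy let_ lez.
move=> c1 c2 c3 r1 r2 r3 ltc ltr; rewrite /transpose.
have := S_D _ _ _ _ _ _ ltr ltc; apply: contraNN.
by case/and5P=> -> -> -> -> /and5P[-> -> -> -> ->].
Qed.

(** The outer rows [r1] and [r3] of a copy of [D] contain cells, so neither is the removed row, and
    the two corners missing from the copy are already missing in [S]. *)
Lemma D_free_skew_drop S y0 : (forall x y, S x y -> y0 <= y) ->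
  D_free_skew S -> D_free_skew (drop_row S y0).
Proof.
move=> S_bot [S_le S_conv S_D]; split.
- by move=> x y /andP[/S_le].
- move=> x y x' y' z t /andP[Sxy _] /andP[Sxy' ne] lez let_.
  rewrite /drop_row (S_conv _ _ _ _ _ _ Sxy Sxy') //.
  by have := S_bot _ _ Sxy'; lia.
- move=> c1 c2 c3 r1 r2 r3 ltc ltr; have := S_D _ _ _ _ _ _ ltc ltr.
  apply: contraNN; rewrite /drop_row.
  case/and5P=> /andP[-> n1] /andP[-> n2] + /andP[-> _]
    /and5P[/andP[-> _] /andP[-> n3] + /andP[-> _] /andP[-> _]].
  by rewrite n1 n3 !andbT => -> ->.
Qed.

Definition ncells S := \sum_(x < M.+1) \sum_(y < M.+1) S x y.

Lemma ncells_tr S : ncells (transpose S) = ncells S.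
Proof. by rewrite /ncells exchange_big. Qed.

Lemma ncells_drop S x y : x <= M -> y <= M -> S x y ->
  ncells (drop_row S y) < ncells S.
Proof.
move=> lex ley Sxy; have ltx : x < M.+1 by []; have lty : y < M.+1 by [].
have le_drop x' y' : drop_row S y x' y' <= S x' y'.
  by rewrite /drop_row; case: (S x' y'); case: (y' != y).
rewrite /ncells (bigD1 (Ordinal ltx)) //= [in X in _ < X](bigD1 (Ordinal ltx)) //=.
rewrite -addSn leq_add //; last by do 2!apply: leq_sum => ? _.
rewrite (bigD1 (Ordinal lty)) //= [in X in _ < X](bigD1 (Ordinal lty)) //=.
rewrite {1}/drop_row eqxx andbF Sxy add0n add1n ltnS.
by apply: leq_sum => ? _.
Qed.

Lemma equinum_corner S k x0 y0 : D_free_skew S -> S x0 y0 ->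
    (forall x y, S x y -> y0 <= y) -> (forall x y, S x y -> x0 <= x) ->
    (forall x y, S x y0 -> S x y = S x0 y) ->
    (forall m, equinum M (drop_row S y0) m.+1) ->
  equinum M S k.+1.
Proof.
move=> gS S00 S_bot S_left S_col; have [S_le S_conv _] := gS.
have ex_x : exists x, S x y0 by exists x0.
have max_x x : S x y0 -> x <= M by case/S_le/andP.
case: (ex_maxnP ex_x max_x) => r Sr max_r.
have le_r := S_left _ _ Sr.
have S_row x : S x y0 = (x0 <= x <= x0 + (r - x0)).
  rewrite subnKC //; apply/idP/idP => [Sx|lex].
    by rewrite (S_left _ _ Sx) max_r.
  by apply: S_conv S00 Sr lex _; rewrite leqnn.
apply: (@equinum_peel M S k x0 (r - x0) y0) => //.
- by rewrite subnKC // max_x.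
- by case/andP: (S_le _ _ S00).
- by move=> x y lex; apply: S_col; rewrite S_row.
- move=> x y y' z Sy Sy' lez; apply: S_conv Sy' Sy _ lez.
  by rewrite leqnn.
Qed.

(** The induction on the number of cells runs over all shapes at once, because the row to be removed
    may belong to the transpose. *)
Theorem equinum_D_free S k : D_free_skew S -> equinum M S k.+1.
Proof.
have [m le_m] := ubnP (ncells S); elim: m S k le_m => // m IHm S k /ltnSE le_m gS.
have [S_le S_conv S_D] := gS.
have [[x1 y1] /= S11|no_S] := pickP (fun c : 'I_M.+1 * 'I_M.+1 => S c.1 c.2); last first.
  have S0 x y : S x y = false.
    apply/negP => Sxy; have /andP[lex ley] := S_le _ _ Sxy.
    have := no_S (inord x, inord y); rewrite /= !inordK ?ltnS //.
    by rewrite Sxy.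
  move=> K; apply: eq_count => phi.
  have av b : avoids b S k.+1 phi.
    apply/avoidsP => -[|p s] // _; apply/negP => /chainP[_ _ sS _].
    by have := sS p p (mem_head _ _) (mem_head _ _); rewrite S0.
  by rewrite !av.
have ex_x : exists x, [exists y : 'I_M.+1, S x y].
  by exists x1; apply/existsP; exists y1.
have ex_y : exists y, [exists x : 'I_M.+1, S x y].
  by exists y1; apply/existsP; exists x1.
case: (ex_minnP ex_x) => x0 /existsP[y' Sx0] min_x.
case: (ex_minnP ex_y) => y0 /existsP[x' Sy0] min_y.
have S_left x y : S x y -> x0 <= x.
  move=> Sxy; apply: min_x; apply/existsP; have /andP[_ ley] := S_le _ _ Sxy.
  by exists (inord y); rewrite inordK.
have S_bot x y : S x y -> y0 <= y.
  move=> Sxy; apply: min_y; apply/existsP; have /andP[lex _] := S_le _ _ Sxy.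
  by exists (inord x); rewrite inordK.
(* Convexity between a cell of the leftmost column and one of the bottom row. *)
have S00 : S x0 y0.
  by apply: (S_conv _ _ _ _ _ _ Sx0 Sy0); rewrite leqnn ?(S_left _ _ Sy0) ?(S_bot _ _ Sx0).
have /andP[le_x0 le_y0] := S_le _ _ S00.
have [/forallP col_eq|] := boolP [forall x : 'I_M.+1, forall y : 'I_M.+1,
    S x y0 ==> (S x y == S x0 y)].
  apply: (@equinum_corner S k x0 y0) => //.
    move=> x y Sx; have /andP[lex _] := S_le _ _ Sx.
    case: (leqP y M) => [ley|lty]; last first.
      by apply/idP/idP => /S_le/andP[_]; rewrite leqNgt lty.
    have /forallP/(_ (inord y)) := col_eq (inord x).
    by rewrite !inordK // Sx => /eqP.
  move=> k'; apply: IHm; last exact: D_free_skew_drop.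
  by apply: leq_trans (ncells_drop le_x0 le_y0 S00) le_m.
rewrite negb_forall => /existsP[c2]; rewrite negb_forall => /existsP[r3].
rewrite negb_imply => /andP[Sc2 ne_S].
have [S03|nS03] := boolP (S x0 r3).
  case/eqP: ne_S; rewrite S03; apply: (S_conv _ _ _ _ _ _ S03 Sc2).
    by rewrite leqnn (S_left _ _ Sc2).
  by rewrite leqnn (S_bot _ _ S03).
have Sc23 : S c2 r3 by move: ne_S; rewrite (negPf nS03); case: (S c2 r3).
(* Column [c2] contains a cell in row [r3] where column [x0] has none. If two rows meeting column
   [x0] differed as well, in column [c3], say, then columns [x0 < c2 < c3] and rows [y0 < r2 < r3]
   would form a copy of [D]. *)
apply: equinum_tr; apply: (@equinum_corner (transpose S) k y0 x0).
- exact: D_free_skew_tr.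
- exact: S00.
- by move=> x y; apply: S_left.
- by move=> x y; apply: S_bot.
- move=> r2 c3 S02; rewrite /transpose in S02 *.
  apply/idP/idP => [S32|S30]; last first.
    apply: (S_conv _ _ _ _ _ _ S02 S30); first by rewrite leqnn (S_left _ _ S30).
    by rewrite leqnn (S_bot _ _ S02).
  apply/idPn => nS30.
  have lt_c : c2 < c3.
    rewrite ltnNge; apply/negP => lec; case/negP: nS30.
    by apply: (S_conv _ _ _ _ _ _ S00 Sc2); rewrite ?leqnn ?lec ?(S_left _ _ S32).
  have lt_r : r2 < r3.
    rewrite ltnNge; apply/negP => ler; case/negP: nS03.
    by apply: (S_conv _ _ _ _ _ _ S02 S00); rewrite ?leqnn ?ler ?(S_bot _ _ Sc23).
  have lt_c1 : x0 < c2.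
    rewrite ltn_neqAle (S_left _ _ Sc2) andbT; apply/eqP => ec.
    by rewrite -ec (negPf nS03) in Sc23.
  have lt_r1 : y0 < r2.
    rewrite ltn_neqAle (S_bot _ _ S02) andbT; apply/eqP => er.
    by rewrite -er (negPf nS30) in S32.
  have := S_D x0 c2 c3 y0 r2 r3.
  rewrite lt_c1 lt_c lt_r1 lt_r => /(_ isT isT)/negP; apply.
  rewrite S00 S02 nS03 Sc2 Sc23 nS30 S32 /=; apply/andP; split.
    by apply: (S_conv _ _ _ _ _ _ S02 Sc2); rewrite ?leqnn ?(ltnW lt_c1) ?(ltnW lt_r1).
  by apply: (S_conv _ _ _ _ _ _ Sc23 S32); rewrite ?leqnn ?(ltnW lt_c) ?(ltnW lt_r).
move=> k'; apply: IHm; last first.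
  by apply: D_free_skew_drop (D_free_skew_tr gS) => x y; apply: S_left.
apply: leq_trans le_m; rewrite -(ncells_tr S).
exact: (@ncells_drop (transpose S) y0 x0).
Qed.

End Transpose.

(** * Grid shapes *)

Lemma mem_shapeD (i j : 'I_3) : ((i, j) \in shapeD) =
  ~~ ((i == 2 :> nat) && (j == 0 :> nat)) && ~~ ((i == 0 :> nat) && (j == 2 :> nat)).
Proof. by rewrite !inE -!pair_eqE /= -!val_eqE. Qed.

Section GridShapes.

Variables (w h : nat) (S : grid_shape w h).
Let M := maxn w h.

Implicit Types (f : filling S) (b : bool).

Definition in_shape x y : bool :=
  [exists c : 'I_w * 'I_h, [&& c \in S, c.1 == x :> nat & c.2 == y :> nat]].

Lemma in_shapeE (i : 'I_w) (j : 'I_h) : in_shape i j = ((i, j) \in S).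
Proof.
apply/existsP/idP => [[[i' j'] /and3P[S' /eqP/val_inj <- /eqP/val_inj <-]] //|Sij].
by exists (i, j); rewrite Sij !eqxx.
Qed.

Lemma in_shapeP (x y : nat) :
  reflect (exists (i : 'I_w) (j : 'I_h), [/\ x = i :> nat, y = j :> nat & (i, j) \in S])
          (in_shape x y).
Proof.
apply: (iffP existsP) => [[[i j] /and3P[Sij /eqP <- /eqP <-]]|[i [j [-> -> Sij]]]].
  by exists i, j.
by exists (i, j); rewrite Sij !eqxx.
Qed.

Lemma in_shape_le x y : in_shape x y -> (x <= M) && (y <= M).
Proof.
case/in_shapeP=> i [j [-> -> _]]; have := ltn_ord i; have := ltn_ord j.
by rewrite /M; lia.
Qed.

Definition to_board f : board M := mkboard M (fun x y =>
  \sum_(c : cell S | ((val c).1 == x :> nat) && ((val c).2 == y :> nat)) f c).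

Definition of_board (phi : board M) : filling S :=
  [ffun c : cell S => entry phi (val c).1 (val c).2].

Lemma entry_to_board f (c : cell S) : entry (to_board f) (val c).1 (val c).2 = f c.
Proof.
have : in_shape (val c).1 (val c).2 by rewrite in_shapeE -surjective_pairing (valP c).
move=> /in_shape_le/andP[lex ley]; rewrite entry_mkboard // (bigD1 c) ?eqxx //=.
rewrite big1 ?addn0 // => c' /andP[/andP[/eqP/val_inj e1 /eqP/val_inj e2] /eqP[]].
by apply/val_inj; rewrite /= [LHS]surjective_pairing e1 e2 -surjective_pairing.
Qed.

Lemma supported_to_board f : supported in_shape (to_board f).
Proof.
apply/supportedP => x y gt0; have /andP[lex ley] := entry_gt0 gt0.
move: gt0; rewrite entry_mkboard //; apply: contraLR => nS.
rewrite -leqNgt leqn0 big1 // => c /andP[/eqP xE /eqP yE]; case/negP: nS.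
by rewrite -xE -yE in_shapeE -surjective_pairing (valP c).
Qed.

Lemma to_boardK f : of_board (to_board f) = f.
Proof. by apply/ffunP => c; rewrite ffunE entry_to_board. Qed.

Lemma of_boardK (phi : board M) :
  supported in_shape phi -> to_board (of_board phi) = phi.
Proof.
move=> sup; apply: entry_inj => x y _ _.
case: (boolP (in_shape x y)) => [/in_shapeP[i [j [-> -> Sij]]]|nS].
  by have := entry_to_board (of_board phi) (exist (fun c => c \in S) (i, j) Sij);
     rewrite ffunE.
have e0 psi : supported in_shape psi -> entry psi x y = 0.
  move=> /supportedP/(_ x y); case: (entry psi x y) => // m /(_ isT).
  by rewrite (negPf nS).
by rewrite !e0 // supported_to_board.
Qed.

Lemma row_sumE f (j : 'I_h) : row_sum f j = rowsum (to_board f) j.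
Proof.
have ltj : j <= M by have := ltn_ord j; rewrite /M; lia.
have ltx (c : cell S) : (val c).1 < M.+1.
  by have := ltn_ord (val c).1; rewrite /M; lia.
rewrite /row_sum /rowsum (partition_big (fun c => Ordinal (ltx c)) xpredT) //=.
apply: eq_bigr => x _; rewrite entry_mkboard ?leq_ord //; apply: eq_bigl => c.
by rewrite -!val_eqE /= andbC.
Qed.

Lemma col_sumE f (i : 'I_w) : col_sum f i = colsum (to_board f) i.
Proof.
have lti : i <= M by have := ltn_ord i; rewrite /M; lia.
have lty (c : cell S) : (val c).2 < M.+1.
  by have := ltn_ord (val c).2; rewrite /M; lia.
rewrite /col_sum /colsum (partition_big (fun c => Ordinal (lty c)) xpredT) //=.
apply: eq_bigr => y _; rewrite entry_mkboard ?leq_ord //; apply: eq_bigl => c.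
Qed.

Definition diag_fill b k : filling (square k) :=
  if b then delta_fill k else iota_fill k.

Definition diag_row b k (i : 'I_k) : 'I_k := if b then rev_ord i else i.

Lemma diag_rowK b k : involutive (@diag_row b k).
Proof. by case: b => i //=; apply: rev_ordK. Qed.

Lemma diag_fillE b k (c : cell (square k)) :
  diag_fill b k c = ((val c).2 == diag_row b (val c).1).
Proof.
rewrite /diag_fill /diag_row; case: b; rewrite ffunE; move: (val c) => [i j] /=.
  congr nat_of_bool; rewrite -val_eqE /=.
  by have := ltn_ord i; have := ltn_ord j; lia.
by rewrite eq_sym.
Qed.

Lemma entry_read_gt0 f b (i : 'I_w) (j : 'I_h) :
  rentry b (to_board f) i (read M b j) = entry (to_board f) i j.
Proof. by rewrite -entry_read //; have := ltn_ord j; rewrite /M; lia. Qed.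

Lemma fcontains_chain f b k : fcontains f (diag_fill b k) ->
  ~~ avoids b in_shape k (to_board f).
Proof.
case=> c [r [[c_homo r_homo cr_S] val_le]].
have rc_S i j : (c i, r j) \in S by rewrite -cr_S inE.
have le_r j : r j <= M by have := ltn_ord (r j); rewrite /M; lia.
pose s := [seq (c i : nat, read M b (r (diag_row b i))) | i <- enum 'I_k].
have sz_s : size s = k by rewrite size_map size_enum_ord.
have c_inj : injective c.
  move=> i j eq_c; apply/eqP; rewrite -val_eqE; case: ltngtP => // lt_ij;
  by have := c_homo _ _ lt_ij; rewrite eq_c ltnn.
have s_lt (i j : 'I_k) : i < j ->
    lt2 (c i : nat, read M b (r (diag_row b i))) (c j : nat, read M b (r (diag_row b j))).
  move=> lt_ij; rewrite /lt2 /= c_homo //=; case: b {s sz_s val_le} => /=; last exact: r_homo.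
  have lt_r : r (rev_ord j) < r (rev_ord i).
    by apply: r_homo => /=; have := ltn_ord j; lia.
  by have := le_r (rev_ord i); lia.
apply/negP => /avoidsP/(_ s sz_s)/chainP; apply; split.
- by rewrite map_inj_uniq ?enum_uniq // => i j [/val_inj/c_inj].
- move=> _ _ /mapP[i _ ->] /mapP[j _ ->].
  case: (ltngtP i j) => [/s_lt ->|/s_lt ->|/val_inj ->]; rewrite ?orbT ?eqxx //.
- by move=> _ _ /mapP[i _ ->] /mapP[j _ ->]; rewrite /= readK // in_shapeE rc_S.
move=> _ /mapP[i _ ->]; rewrite /= entry_read_gt0.
have sq : (i, diag_row b i) \in square k by rewrite inE.
pose x : cell (square k) := exist (fun x => x \in square k) _ sq.
pose y : cell S := exist (fun y => y \in S) _ (rc_S i (diag_row b i)).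
have := val_le x y erefl.
by rewrite diag_fillE eqxx -entry_to_board.
Qed.

Lemma chain_fcontains f b k : ~~ avoids b in_shape k (to_board f) ->
  fcontains f (diag_fill b k).
Proof.
case/negPn/existsP=> t; set s0 := map _ _ => /chainP[us0 s0_lt s0_S s0_gt0].
(* Sorting by column turns the unordered chain into an increasing choice of columns. *)
pose s := sort (fun p q : nat * nat => p.1 <= q.1) s0.
have mem_s : s =i s0 by move=> p; rewrite mem_sort.
have sz_s : size s = k by rewrite size_sort size_map size_tuple.
pose p (i : 'I_k) := nth (0, 0) s i.
have p_s0 i : p i \in s0 by rewrite -mem_s mem_nth ?sz_s.
have s_sorted : {in [pred n | n < size s] &,
    {homo nth (0, 0) s : i j / i <= j >-> i.1 <= j.1}}.
  apply: sorted_leq_nth.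
  - by move=> q q' q''; apply: leq_trans.
  - by move=> q; apply: leqnn.
  - by apply: sort_sorted => q q'; apply: leq_total.
have p_lt (i j : 'I_k) : i < j -> lt2 (p i) (p j).
  move=> lt_ij; have := s0_lt _ _ (p_s0 i) (p_s0 j).
  have -> : p i == p j = false.
    by rewrite nth_uniq ?sz_s ?sort_uniq // ltn_eqF.
  have : (p i).1 <= (p j).1.
    by apply: s_sorted; rewrite ?inE ?sz_s ?ltn_ord //; exact: ltnW.
  by move=> le_ij /=; case/orP=> // /andP[+ _]; rewrite ltnNge le_ij.
have p_S i j : in_shape (p i).1 (read M b (p j).2) by apply: s0_S.
have [c cE] : exists c : 'I_k -> 'I_w, forall i, (p i).1 = c i.
  apply: (@fin_all_exists _ (fun=> 'I_w) (fun i a => (p i).1 = a)) => i.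
  have /in_shapeP[a [_ [-> _ _]]] := p_S i i.
  by exists a.
have [r' r'E] : exists r : 'I_k -> 'I_h, forall i, read M b (p i).2 = r i.
  apply: (@fin_all_exists _ (fun=> 'I_h) (fun i a => read M b (p i).2 = a)) => i.
  have /in_shapeP[_ [a [_ -> _]]] := p_S i i.
  by exists a.
have p_le i : (p i).2 <= M.
  by have /andP[] := rentry_gt0 (s0_gt0 _ (p_s0 i)).
have read_lt (i j : 'I_k) : i < j ->
    read M b (p (diag_row b i)).2 < read M b (p (diag_row b j)).2.
  move=> lt_ij; rewrite /read /diag_row; case: (b); last by case/andP: (p_lt _ _ lt_ij).
  have /andP[_] : lt2 (p (rev_ord j)) (p (rev_ord i)).
    by apply: p_lt => /=; have := ltn_ord j; lia.
  by have := p_le (rev_ord i); lia.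
(* For [b = true] the rows decrease along the chain and are listed backwards. *)
pose r j := r' (diag_row b j).
have cr_S i j : (c i, r j) \in S by rewrite -in_shapeE -cE -r'E.
exists c, r; split; first split.
- by move=> i j /p_lt/andP[]; rewrite !cE.
- by move=> i j /read_lt; rewrite /r -!r'E.
- by move=> i j; rewrite cr_S inE.
move=> x y yE; rewrite diag_fillE; case: eqP => // xE.
rewrite -entry_to_board yE /= xE /r diag_rowK -r'E -cE.
by rewrite (entry_read b) ?read_le // readK // s0_gt0.
Qed.

Lemma favoidsE f b k :
  favoids f (diag_fill b k) <-> avoids b in_shape k (to_board f).
Proof.
split=> [nc|av /fcontains_chain]; last by rewrite av.
case: (boolP (avoids b in_shape k (to_board f))) => // nav.
by case: nc; apply: chain_fcontains.
Qed.

(** In [F1], the cell [(z, t)] is reached from [(x', y')] by going left and then up. If it were in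
    [F2], going left and up from it would put [(x, y)] into [F2] too. *)
Lemma in_shape_conv x y x' y' z t : skew_shape S ->
    in_shape x y -> in_shape x' y' -> x <= z <= x' -> y' <= t <= y ->
  in_shape z t.
Proof.
case=> a [c [F1 [F2 [[row1 col1 left1 top1] [row2 col2 left2 top2] SE]]]].
have inE' x1 y1 : in_shape x1 y1 =
    ((Posz x1.+1, Posz y1.+1) \in F1) && ((Posz x1.+1, Posz y1.+1) \notin F2).
  rewrite andbC -in_fsetD -SE; apply/in_shapeP/imfsetP => /=.
    by case=> i [j [-> -> Sij]]; exists (i, j).
  by case=> -[i j] Sij [-> ->]; exists i, j.
rewrite !inE' => /andP[F1xy nF2xy] /andP[F1xy' _] lez let_.
have [F1a le_a] := left1 _ _ F1xy; have [F1a' le_a'] := left1 _ _ F1xy'.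
have [_ le_c] := top1 _ _ F1xy.
have F1zy' : (Posz z.+1, Posz y'.+1) \in F1.
  by apply: (row1 _ _ _ _ F1a' F1xy'); lia.
have [F1zc _] := top1 _ _ F1zy'.
apply/andP; split; first by apply: (col1 _ _ _ _ F1zy' F1zc); lia.
apply: contra nF2xy => F2zt; have [F2at _] := left2 _ _ F2zt.
have F2xt : (Posz x.+1, Posz t.+1) \in F2.
  by apply: (row2 _ _ _ _ F2at F2zt); lia.
have [F2xc _] := top2 _ _ F2xt.
by apply: (col2 _ _ _ _ F2xt F2xc); lia.
Qed.

Lemma in_shape_D_free : D_free S -> forall c1 c2 c3 r1 r2 r3,
  c1 < c2 < c3 -> r1 < r2 < r3 ->
    ~~ [&& in_shape c1 r1, in_shape c1 r2, ~~ in_shape c1 r3, in_shape c2 r1,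
           in_shape c2 r2, in_shape c2 r3, ~~ in_shape c3 r1, in_shape c3 r2
         & in_shape c3 r3].
Proof.
move=> nD c1 c2 c3 r1 r2 r3 /andP[lt_c1 lt_c2] /andP[lt_r1 lt_r2].
apply/negP => /and5P[S11 S12 S13 S21 /and5P[S22 S23 S31 S32 S33]]; apply: nD.
have /in_shapeP[i1 [j1 [e1 f1 _]]] := S11.
have /in_shapeP[i2 [j2 [e2 f2 _]]] := S22.
have /in_shapeP[i3 [j3 [e3 f3 _]]] := S33.
exists (tnth [tuple i1; i2; i3]), (tnth [tuple j1; j2; j3]); split.
- by case=> [[|[|[|i]]] lti] [[|[|[|j]]] ltj] //= _;
    rewrite !(tnth_nth i1) /= -?e1 -?e2 -?e3 // (ltn_trans lt_c1).
- by case=> [[|[|[|i]]] lti] [[|[|[|j]]] ltj] //= _;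
    rewrite !(tnth_nth j1) /= -?f1 -?f2 -?f3 // (ltn_trans lt_r1).
move: S11 S12 S13 S21 S22 S23 S31 S32 S33; rewrite e1 e2 e3 f1 f2 f3 !in_shapeE.
move=> S11 S12 /negPf S13 S21 S22 S23 /negPf S31 S32 S33.
by case=> [[|[|[|i]]] lti] [[|[|[|j]]] ltj] //;
  rewrite mem_shapeD !(tnth_nth i1) !(tnth_nth j1) /=
    ?S11 ?S12 ?S13 ?S21 ?S22 ?S23 ?S31 ?S32 ?S33.
Qed.

Lemma in_shape_D_free_skew :
  skew_shape S -> D_free S -> D_free_skew M in_shape.
Proof.
move=> skS DS; split; [exact: in_shape_le|by move=> x y x' y' z t; apply: in_shape_conv|].
exact: in_shape_D_free.
Qed.

End GridShapes.

Theorem theorem2p2 (h w : nat) (S : grid_shape w h)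
    (hsize : has_size S) (hskew : skew_shape S) (hD : D_free S) :
  exists f : filling S -> filling S,
    [/\ bijective f,
        forall (k : nat) (phi : filling S), 1 <= k ->
          (favoids phi (delta_fill k) <-> favoids (f phi) (iota_fill k))
      & exists (rho : {perm 'I_h}) (sigma : {perm 'I_w}),
          forall phi : filling S,
            (forall i : 'I_h, row_sum phi i = row_sum (f phi) (rho i)) /\
            (forall i : 'I_w, col_sum phi i = col_sum (f phi) (sigma i))].
Proof.
have gS := in_shape_D_free_skew hskew hD.
have [g [g' [gK g'K gP]]] := equinum_bij (fun k => equinum_D_free k gS).
pose F (phi : filling S) := of_board S (g (to_board phi)).
pose F' (phi : filling S) := of_board S (g' (to_board phi)).
have supg (phi : filling S) : supported (in_shape S) (g (to_board phi)).
  by case: (gP (to_board phi)) => _ -> _; apply: supported_to_board.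
have supg' (phi : filling S) : supported (in_shape S) (g' (to_board phi)).
  by case: (gP (g' (to_board phi))) => _ <- _; rewrite g'K supported_to_board.
have F_board (phi : filling S) : to_board (F phi) = g (to_board phi) by apply: of_boardK.
exists F; split.
- exists F' => phi; first by rewrite /F' F_board gK to_boardK.
  by rewrite /F [to_board _]of_boardK // g'K to_boardK.
- move=> [//|k] phi _.
  have [_ _ /(_ (supported_to_board phi) k) avE] := gP (to_board phi).
  rewrite (favoidsE phi true) (favoidsE (F phi) false) F_board avE.
  by [].
exists 1%g, 1%g => phi; have [/pair_equal_spec[/ffunP rE /ffunP cE] _ _] := gP (to_board phi).
split=> i; rewrite perm1.
  rewrite !row_sumE F_board; have lti : i < (maxn w h).+1 by have := ltn_ord i; lia.
  by have := rE (Ordinal lti); rewrite !ffunE.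
rewrite !col_sumE F_board; have lti : i < (maxn w h).+1 by have := ltn_ord i; lia.
by have := cE (Ordinal lti); rewrite !ffunE.
Qed.
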